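(* Let $\phi:X\to G$ be a measurable function (cocycle) and let $P_\phi\in\mathscr B\big(L^2(X,\mathfrak g)\big)$ be the orthogonal projection onto $\ker(1-W_\phi)$. (a) If $f\in L^2(X,\mathfrak g)$, then the sequence $\frac1N\sum_{n=0}^{N-1}W_\phi^nf$ converges in $L^2(X,\mathfrak g)$ to $P_\phi f$ as $N\to\infty$. (b) If $f\in L^1(X,\mathfrak g)$, then the sequence $\frac1N\sum_{n=0}^{N-1}\big(W_\phi^nf\big)(x)$ converges in $\mathfrak g$ for $\mu_X$-almost every $x\in X$. (c) If $f\in L^2(X,\mathfrak g)$, then the sequence $\frac1N\sum_{n=0}^{N-1}\big(W_\phi^nf\big)(x)$ converges in $\mathfrak g$ to $(P_\phi f)(x)$ for $\mu_X$-almost every $x\in X$.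
   Context: $X$ is a smooth compact second countable Hausdorff manifold with Borel probability measure $\mu_X$, and $\{F_t\}_{t\in\mathbb R}$ is a $C^1$ flow on $X$ preserving $\mu_X$. $G$ is a compact Lie group with Lie algebra $\mathfrak g$, endowed with an $\mathrm{Ad}$-invariant scalar product $\langle\cdot,\cdot\rangle_{\mathfrak g}$ with norm $\|\cdot\|_{\mathfrak g}$, where $\mathrm{Ad}_gZ=gZg^{-1}$ for $g\in G$, $Z\in\mathfrak g$. $L^2(X,\mathfrak g)$ is the Hilbert space of ($\mu_X$-classes of) measurable functions $X\to\mathfrak g$ with scalar product $\int_Xd\mu_X(x)\,\langle f_1(x),f_2(x)\rangle_{\mathfrak g}$, and $L^1(X,\mathfrak g)$ is the Banach space of measurable functions $f:X\to\mathfrak g$ with norm $\int_Xd\mu_X(x)\,\|f(x)\|_{\mathfrak g}<\infty$. $W_\phi$ is defined by $(W_\phi f)(x):=\mathrm{Ad}_{\phi(x)}f(F_1(x))$; it is a unitary operator in $L^2(X,\mathfrak g)$, and its iterates are $(W_\phi^nf)(x)=\mathrm{Ad}_{\phi^{(n)}(x)}f(F_n(x))$ with $\phi^{(0)}=e_G$ (identity of $G$) and $\phi^{(n)}(x)=\phi(x)\phi(F_1(x))\cdots\phi(F_{n-1}(x))$ for $n\ge1$. The same formulas define $W_\phi^n f$ for $f\in L^1(X,\mathfrak g)$. *)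

(* Defs.v *)
From HB Require Import structures.
From mathcomp Require Import all_boot all_order all_algebra.
From mathcomp Require Import all_classical all_reals all_analysis.

Set Implicit Arguments.
Unset Strict Implicit.
Unset Printing Implicit Defensive.

Import Order.TTheory GRing.Theory Num.Theory.
Import numFieldNormedType.Exports.

Local Open Scope classical_set_scope.
Local Open Scope ring_scope.

Notation borel T := (g_sigma_algebraType (@open T)).

Section Smoothness.
Context {R : realType}.

(* To be used with [U] open.  In finite dimension, [f] is of class C^(k+1) iff
   it is differentiable and all its directional derivatives are of class C^k. *)
Fixpoint Ck_on {V W : normedModType R} (k : nat) (U : set V) (f : V -> W)
    : Prop :=
  if k is k'.+1 then
    (forall x, U x -> differentiable f x) /\
    (forall v : V, Ck_on k' U (fun x => 'd f x v))
  else forall x, U x -> {for x, continuous f}.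

(* [coord] is relevant only on [dom], and [param] only on [coord @` dom]. *)
Record chart (E : normedModType R) (M : topologicalType) := Chart {
  dom : set M;
  coord : M -> E;
  param : E -> M
}.

Definition is_chart (E : normedModType R) (M : topologicalType)
    (c : chart E M) : Prop :=
  [/\ open (dom c),
      open (coord c @` dom c),
      {within dom c, continuous (coord c)},
      {within coord c @` dom c, continuous (param c)} &
      forall x, dom c x -> param c (coord c x) = x].

Definition smooth_atlas (E : normedModType R) (M : topologicalType)
    (A : set (chart E M)) : Prop :=
  [/\ forall c, A c -> is_chart c,
      forall x : M, exists2 c, A c & dom c x &
      forall c c', A c -> A c' -> forall k,
        Ck_on k (coord c @` (dom c `&` dom c')) (coord c' \o param c)].

Definition smooth_manifold (n : nat) (M : topologicalType)
    (A : set (chart 'rV[R]_n M)) : Prop :=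
  [/\ hausdorff_space M, @second_countable M & smooth_atlas A].

Definition line_atlas : set (chart R R) := [set Chart setT id id].

Definition prod_chart (E E' : normedModType R) (M M' : topologicalType)
    (c : chart E M) (c' : chart E' M') : chart (E * E')%type (M * M')%type :=
  Chart (dom c `*` dom c')
        (fun p => (coord c p.1, coord c' p.2))
        (fun v => (param c v.1, param c' v.2)).

Definition prod_atlas (E E' : normedModType R) (M M' : topologicalType)
    (A : set (chart E M)) (A' : set (chart E' M')) :
    set (chart (E * E')%type (M * M')%type) :=
  [set p | exists c c', [/\ A c, A' c' & p = prod_chart c c']].

Definition Ck_map (E E' : normedModType R) (M M' : topologicalType) (k : nat)
    (A : set (chart E M)) (A' : set (chart E' M')) (f : M -> M') : Prop :=
  continuous f /\
  forall c c', A c -> A' c' ->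
    Ck_on k (coord c @` (dom c `&` f @^-1` dom c'))
      (coord c' \o f \o param c).

Definition C1_flow (E : normedModType R) (M : topologicalType)
    (A : set (chart E M)) (F : R -> M -> M) : Prop :=
  [/\ forall x, F 0 x = x,
      forall s t x, F (s + t) x = F s (F t x) &
      Ck_map 1 (prod_atlas line_atlas A) A (fun p : R * M => F p.1 p.2)].

End Smoothness.

(* A type with a topology and a group law; their compatibility is part of
   [lie_group]. *)
#[short(type="groupTopologicalType")]
HB.structure Definition GroupTopological :=
  { G of Group G & PointedTopological G }.

Section LieGroup.
Context {R : realType} {d : nat} {G : groupTopologicalType}.
Implicit Types (A : set (chart 'rV[R]_d G)) (c : chart 'rV[R]_d G).

Definition lie_group A : Prop :=
  [/\ smooth_manifold A,
      forall k, Ck_map k (prod_atlas A A) A (fun p : G * G => (p.1 * p.2)%g) &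
      forall k, Ck_map k A A (fun g : G => g^-1%g)].

(* The Lie algebra is the tangent space of [G] at the identity.  A chart [c]
   around the identity identifies it with ['rV[R]_d], and [Ad c g] is, in these
   coordinates, the differential at the identity of x |-> g x g^-1. *)
Definition Ad c (g : G) : 'rV[R]_d -> 'rV[R]_d :=
  'd (coord c \o (fun x : G => (g * x * g^-1)%g) \o param c) (coord c 1%g).

Definition scalar_product (ip : 'rV[R]_d -> 'rV[R]_d -> R) : Prop :=
  [/\ forall a u v w, ip (a *: u + v) w = a * ip u w + ip v w,
      forall u v, ip u v = ip v u &
      forall u, u != 0 -> 0 < ip u u].

Definition Ad_invariant c (ip : 'rV[R]_d -> 'rV[R]_d -> R) : Prop :=
  forall g u v, ip (Ad c g u) (Ad c g v) = ip u v.

End LieGroup.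

Section Lebesgue.
Context {R : realType} {d : nat} {X : ptopologicalType}.
Variables (mu : probability (borel X) R) (ip : 'rV[R]_d -> 'rV[R]_d -> R).
Implicit Types f g h : X -> 'rV[R]_d.

(* Elements of L^p(X, g) are represented by functions, to be considered up to
   equality mu-almost everywhere. *)

Definition LpNorm (p : \bar R) f : \bar R :=
  'N[mu]_p[(fun x : borel X => (Num.sqrt (ip (f x) (f x)))%:E)]%E.

Definition in_Lp (p : \bar R) f : Prop :=
  measurable_fun [set: borel X] (f : borel X -> borel 'rV[R]_d) /\
  (LpNorm p f < +oo)%E.

Definition L2_dot f g : R :=
  \int[mu]_(x in [set: borel X]) ip (f x) (g x).

(* A representative of the class of the orthogonal projection of [f] onto the
   closed subspace [K] of L^2(X, g): the element h of K such that f - h is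
   orthogonal to K.  The default value of [xget] is irrelevant, since such an
   element exists. *)
Definition orth_proj (K : set (X -> 'rV[R]_d)) f : X -> 'rV[R]_d :=
  xget (fun=> 0)
    [set h | K h /\ forall k, K k -> L2_dot (fun x => f x - h x) k = 0].

End Lebesgue.

Section Cocycle.
Context {R : realType} {d : nat} {X : ptopologicalType}
  {G : groupTopologicalType}.
Variables (mu : probability (borel X) R) (F : R -> X -> X).
Variables (c : chart 'rV[R]_d G) (ip : 'rV[R]_d -> 'rV[R]_d -> R).
Variable phi : X -> G.
Implicit Type f : X -> 'rV[R]_d.

Definition flow_preserves : Prop :=
  forall (t : R) (B : set (borel X)), measurable B -> mu (F t @^-1` B) = mu B.

Definition Wphi f : X -> 'rV[R]_d := fun x => Ad c (phi x) (f (F 1 x)).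

Definition ker_1W : set (X -> 'rV[R]_d) :=
  [set h | in_Lp mu ip 2%:E h /\ {ae mu, forall x, h x - Wphi h x = 0}].

Definition Pphi f : X -> 'rV[R]_d := orth_proj mu ip ker_1W f.

Definition ergodic_avg f (N : nat) : X -> 'rV[R]_d :=
  fun x => N%:R^-1 *: \sum_(0 <= n < N) iter n Wphi f x.

End Cocycle.

(* Main.v *)
Require Import Defs.
From HB Require Import structures.
From mathcomp Require Import all_boot all_order all_algebra.
From mathcomp Require Import all_classical all_reals all_analysis.
From mathcomp Require Import measurable_realfun ring lra.

Set Implicit Arguments.
Unset Strict Implicit.
Unset Printing Implicit Defensive.

Import Order.TTheory GRing.Theory Num.Theory.
Import numFieldNormedType.Exports.

Local Open Scope classical_set_scope.
Local Open Scope ring_scope.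

(* The coordinate map of a chart, not the coordinates in a basis. *)
Local Notation coord := Defs.coord.

(** The operator at stake has the form (W f)(x) = A_x (f (tau x)), where tau is
    the time-one map of the flow, which preserves mu, and A_x = Ad (phi x) is a
    linear isometry of the Lie algebra.  Once A is known to be measurable in x,
    manifolds and groups disappear: the theorem holds for every measurable
    field A of linear isometries, because |(W^n f)(x)| = |f (tau^n x)| reduces
    all estimates to scalar functions along orbits.

    Mean convergence.  Write M_N f for the average of W^0 f, ..., W^(N-1) f, and
    call g - W g, with g square-integrable, a coboundary; M_N of it is
    (g - W^N g) / N, which tends to 0.  Let K be the set of all k such that
    f - k is a coboundary.  It is convex, it contains every M_N f, and
    |M_N f| <= |k| + o(1) for every k in K, so |M_N f| tends to the infimum of
    the norm on K; by the parallelogram law the M_N f form a Cauchy sequence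
    (mean_cauchy).  By the completeness of L^2 (L2_complete) they have a limit h,
    which is W-invariant and such that f - h is orthogonal to the invariant
    functions (mean_ergodic).  So h is the projection of f.

    Pointwise convergence.  The maximal inequality of Hopf (maximal_ergodic),
    applied to scalar functions such as |f|, controls all the averages of f at
    once; maximal_ae is the form in which it is used.  For square-integrable f,
    write f - h = (f - M_m f) + (M_m f - h).  The first term is a coboundary,
    so its averages tend to 0 almost everywhere (mean_coboundary_ae), and the
    averages of the second one are uniformly small outside a small set
    because its L^2 norm is small (mean_pointwise).  An integrable f is
    approximated in L^1 by its truncations, which are bounded, and the same
    inequality shows that its averages form a Cauchy sequence almost everywhere
    (mean_pointwise_L1).

    The measurability of x |-> Ad (phi x) v is obtained by writing Ad g v as a
    limit of difference quotients of conjugation by g in a chart, each of which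
    is a Borel function of g (Ad_measurable). *)

(** * Inner products on row vectors *)

Section InnerProduct.
Context {R : realType} {d : nat}.
Variable ip : 'rV[R]_d -> 'rV[R]_d -> R.
Hypothesis ip_scalar : scalar_product ip.

Definition nrm v := Num.sqrt (ip v v).

Lemma ipC u v : ip u v = ip v u.
Proof. by have [_ ->] := ip_scalar. Qed.

Lemma ip0l v : ip 0 v = 0.
Proof.
have [+ _ _] := ip_scalar => /(_ 1 0 0 v); rewrite scaler0 addr0 mul1r => h.
lra.
Qed.

Lemma ipDl u v w : ip (u + v) w = ip u w + ip v w.
Proof. by have [+ _ _] := ip_scalar => /(_ 1 u v w); rewrite scale1r mul1r. Qed.

Lemma ipZl a u v : ip (a *: u) v = a * ip u v.
Proof. by have [+ _ _] := ip_scalar => /(_ a u 0 v); rewrite addr0 ip0l addr0. Qed.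

Lemma ipDr u v w : ip w (u + v) = ip w u + ip w v.
Proof. by rewrite !(ipC w) ipDl. Qed.

Lemma ipZr a u v : ip v (a *: u) = a * ip v u.
Proof. by rewrite !(ipC v) ipZl. Qed.

Lemma ipNl u v : ip (- u) v = - ip u v.
Proof. by rewrite -scaleN1r ipZl mulN1r. Qed.

Lemma ipNr u v : ip v (- u) = - ip v u.
Proof. by rewrite !(ipC v) ipNl. Qed.

Lemma ip_suml I (r : seq I) (P : pred I) (f : I -> 'rV[R]_d) v :
  ip (\sum_(i <- r | P i) f i) v = \sum_(i <- r | P i) ip (f i) v.
Proof.
by apply: (big_morph (fun u => ip u v)) => [x y|]; rewrite ?ipDl ?ip0l.
Qed.

Lemma ip_ge0 v : 0 <= ip v v.
Proof.
have [->|v0] := eqVneq v 0; first by rewrite ip0l.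
by have [_ _ /(_ _ v0)/ltW] := ip_scalar.
Qed.

Lemma ip_eq0 v : ip v v = 0 -> v = 0.
Proof.
move=> vv; apply/eqP; apply: contraT => v0.
by have [_ _ /(_ _ v0)] := ip_scalar; rewrite vv ltxx.
Qed.

Lemma ipNN v : ip (- v) (- v) = ip v v.
Proof. by rewrite ipNl ipNr opprK. Qed.

Lemma ipZZ a v : ip (a *: v) (a *: v) = a ^+ 2 * ip v v.
Proof. by rewrite ipZl ipZr mulrA expr2. Qed.

Lemma ip_coordE u v :
  ip u v = \sum_i \sum_j u 0 i * v 0 j * ip (delta_mx 0 i) (delta_mx 0 j).
Proof.
rewrite {1}(row_sum_delta u) ip_suml; apply: eq_bigr => i _.
rewrite {1}(row_sum_delta v) ipC ip_suml; apply: eq_bigr => j _.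
by rewrite ipZl ipZr ipC mulrCA mulrA.
Qed.

Lemma ip_parallelogram u v :
  ip (u - v) (u - v) + 4 * ip (2^-1 *: (u + v)) (2^-1 *: (u + v)) =
  2 * ip u u + 2 * ip v v.
Proof.
by rewrite ipZZ !ipDl !ipDr !ipNl !ipNr (ipC v u); field.
Qed.

Lemma ipD_le2 u v : ip (u + v) (u + v) <= 2 * ip u u + 2 * ip v v.
Proof.
have := ip_ge0 (u - v).
rewrite !ipDl !ipDr !ipNl !ipNr (ipC v u); lra.
Qed.

(** Expand the squares of [t *: u + v] and [t *: u - v].  The free weight [t] is
    what lets a small term absorb a bounded one. *)
Lemma ip_young t u v : 0 < t -> 2 * `|ip u v| <= t * ip u u + t^-1 * ip v v.
Proof.
move=> t0; rewrite -(@ler_pM2l _ t) // mulrDr (mulrA t t^-1) mulfV ?gt_eqF // mul1r.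
have := ip_ge0 (t *: u - v); have := ip_ge0 (t *: u + v).
rewrite !ipDl !ipDr !ipNl !ipNr !ipZl !ipZr (ipC v u).
by case: (ler0P (ip u v)) => _; lra.
Qed.

Lemma ipD_le t u v : 0 < t ->
  ip (u + v) (u + v) <= (1 + t) * ip u u + (1 + t^-1) * ip v v.
Proof.
move=> t0; have := ip_young u v t0; have := ler_norm (ip u v).
by rewrite ipDl !ipDr (ipC v u); lra.
Qed.

Lemma cauchy_schwarz u v : ip u v ^+ 2 <= ip u u * ip v v.
Proof.
have [u0|u0] := eqVneq (ip u u) 0.
  by rewrite (ip_eq0 u0) !ip0l expr2 !mul0r.
have {}u0 : 0 < ip u u by rewrite lt_def u0 ip_ge0.
have := ip_ge0 (ip u u *: v - ip u v *: u).
rewrite !ipDl !ipDr !ipNl !ipNr !ipZl !ipZr (ipC v u) => h.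
have : 0 <= ip u u * (ip u u * ip v v - ip u v ^+ 2) by rewrite expr2; lra.
by rewrite pmulr_rge0 // subr_ge0.
Qed.

Lemma nrm_ge0 v : 0 <= nrm v.
Proof. exact: sqrtr_ge0. Qed.

Lemma sqr_nrm v : nrm v ^+ 2 = ip v v.
Proof. by rewrite sqr_sqrtr // ip_ge0. Qed.

Lemma nrm0 : nrm 0 = 0.
Proof. by rewrite /nrm ip0l sqrtr0. Qed.

Lemma nrmD u v : nrm (u + v) <= nrm u + nrm v.
Proof.
rewrite -(@ler_pXn2r _ 2) ?nnegrE ?addr_ge0 ?nrm_ge0 //.
rewrite sqr_nrm sqrrD !sqr_nrm ipDl !ipDr (ipC v u).
suff : ip u v <= nrm u * nrm v by rewrite mulr2n; lra.
apply: le_trans (ler_norm _) _.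
rewrite -(@ler_pXn2r _ 2) ?nnegrE ?mulr_ge0 ?nrm_ge0 // exprMn !sqr_nrm.
by rewrite real_normK ?num_real // cauchy_schwarz.
Qed.

Lemma nrmN v : nrm (- v) = nrm v.
Proof. by rewrite /nrm ipNN. Qed.

Lemma nrmZ a v : nrm (a *: v) = `|a| * nrm v.
Proof. by rewrite /nrm ipZZ sqrtrM ?sqr_ge0 // sqrtr_sqr. Qed.

Lemma nrm_sum n (f : nat -> 'rV[R]_d) :
  nrm (\sum_(0 <= i < n) f i) <= \sum_(0 <= i < n) nrm (f i).
Proof.
elim: n => [|n IH]; first by rewrite !big_geq // nrm0.
by rewrite !big_nat_recr //= (le_trans (nrmD _ _)) // lerD2r.
Qed.

Lemma nrm_mean n (f : nat -> 'rV[R]_d) :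
  nrm (n%:R^-1 *: \sum_(0 <= i < n) f i) <=
  n%:R^-1 * \sum_(0 <= i < n) nrm (f i).
Proof. by rewrite nrmZ ger0_norm ?ler_wpM2l ?nrm_sum. Qed.

Lemma ip_sum_le n (f : nat -> 'rV[R]_d) :
  ip (\sum_(0 <= i < n) f i) (\sum_(0 <= i < n) f i) <=
  n%:R * \sum_(0 <= i < n) ip (f i) (f i).
Proof.
elim: n => [|n IH]; first by rewrite !big_geq // ip0l mul0r.
rewrite !big_nat_recr //=.
case: n IH => [|n] IH; first by rewrite !big_geq // !add0r mul1r.
set S := \sum_(0 <= i < n.+1) f i in IH *; set Q := \sum_(0 <= i < n.+1) _ in IH *.
have t0 : 0 < n.+1%:R^-1 :> R by rewrite invr_gt0.
apply: le_trans (ipD_le S (f n.+1) t0) _; rewrite invrK.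
rewrite -[n.+2%:R]/((1 + n.+1)%:R) natrD mulrDr lerD2r.
have : (1 + n.+1%:R^-1) * ip S S <= (1 + n.+1%:R^-1) * (n.+1%:R * Q).
  by rewrite ler_wpM2l // addr_ge0.
rewrite mulrA (_ : (1 + n.+1%:R^-1) * n.+1%:R = 1 + n.+1%:R) //.
by rewrite mulrDl mul1r mulVf ?pnatr_eq0 // addrC.
Qed.

(** Convexity of the square of the norm: it bounds the vector average along an
    orbit by a scalar one, to which the maximal inequality applies. *)
Lemma ip_mean_le n (f : nat -> 'rV[R]_d) :
  let v := n%:R^-1 *: \sum_(0 <= i < n) f i in
  ip v v <= n%:R^-1 * \sum_(0 <= i < n) ip (f i) (f i).
Proof.
rewrite /= ipZZ; case: n => [|n].
  by rewrite invr0 expr2 !mul0r.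
rewrite expr2 -mulrA ler_wpM2l // ler_pdivrMl //.
exact: ip_sum_le.
Qed.

Lemma ip_continuous (T : topologicalType) (f g : T -> 'rV[R]_d) x :
  {for x, continuous f} -> {for x, continuous g} ->
  {for x, continuous (fun y => ip (f y) (g y))}.
Proof.
move=> cf cg.
rewrite (_ : (fun y => _) = (fun y => \sum_i \sum_j f y 0 i * g y 0 j *
  ip (delta_mx 0 i) (delta_mx 0 j))); last by apply/funext => y; rewrite ip_coordE.
have coordP (h : T -> 'rV[R]_d) (ch : {for x, continuous h}) i :
    h y 0 i @[y --> x] --> h x 0 i.
  exact: (cvg_comp _ _ ch (@coord_continuous R 1 d 0 i (h x))).
apply: cvg_big => [|i _]; first exact: add_continuous.
apply: cvg_big => [|j _]; first exact: add_continuous.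
apply: cvgM; last exact: cvg_cst.
by apply: cvgM; exact: coordP.
Qed.

Lemma ip_cvg (u : nat -> 'rV[R]_d) v : u n @[n --> \oo] --> v ->
  ip (u n) (u n) @[n --> \oo] --> ip v v.
Proof.
move=> uv; have ipv : ip w w @[w --> v] --> ip v v.
  by apply: ip_continuous; exact: cvg_id.
exact: (cvg_comp _ _ uv ipv).
Qed.

(** The norm of row vectors is the maximum of the coordinates.  By compactness of
    its unit sphere, [ip] is bounded below there. *)
Lemma norm_le_nrm : exists2 C, 0 < C & forall v, `|v| <= C * nrm v.
Proof.
pose S : set 'rV[R]_d := [set v | `|v| = 1].
have cS : compact S.
  apply: bounded_closed_compact.
    exists 1; split; first exact: num_real.
    by move=> M M1 v /= ->; exact: ltW.
  rewrite (_ : S = Num.norm @^-1` [set 1]) //.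
  apply: closed_comp; last exact: closed_eq.
  by move=> v _; exact: norm_continuous.
have [S0|S0] := pselect (S !=set0).
  have [|w wS wmin] := @compact_EVT_min _ R (fun v => ip v v) S S0 cS.
    apply: continuous_subspaceT => v.
    by apply: ip_continuous; exact: cvg_id.
  have w0 : 0 < ip w w.
    have [_ _ ->//] := ip_scalar.
    rewrite -normr_eq0; move: wS; rewrite inE /S /= => ->.
    exact: oner_neq0.
  have w1 : 0 < nrm w by rewrite sqrtr_gt0.
  exists (nrm w)^-1; first by rewrite invr_gt0.
  move=> v; have [->|v0] := eqVneq v 0; first by rewrite normr0 nrm0 mulr0.
  have nv0 : 0 < `|v| by rewrite normr_gt0.
  rewrite ler_pdivlMl // -ler_pdivlMr //.
  have := wmin (`|v|^-1 *: v); rewrite inE /S /= normrZ normfV normr_id.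
  rewrite mulVf ?gt_eqF // => /(_ erefl) h.
  have : nrm w <= nrm (`|v|^-1 *: v) by rewrite ler_wsqrtr.
  by rewrite nrmZ normfV normr_id mulrC.
exists 1 => // v; have [->|v0] := eqVneq v 0; first by rewrite normr0 nrm0 mulr0.
exfalso; apply: S0; exists (`|v|^-1 *: v).
by rewrite /S /= normrZ normfV normr_id mulVf // normr_eq0.
Qed.

Lemma nrm_cvg (u : nat -> 'rV[R]_d) v :
  nrm (u n - v) @[n --> \oo] --> 0 -> u n @[n --> \oo] --> v.
Proof.
move=> h; have [C C0 Cle] := norm_le_nrm.
apply/cvgrPdist_le => e e0; move/cvgrPdist_le : h => /(_ (C^-1 * e)) h.
have /h : 0 < C^-1 * e by rewrite mulr_gt0 ?invr_gt0.
apply: filterS => n; rewrite sub0r normrN ger0_norm ?nrm_ge0 // => hn.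
rewrite distrC (le_trans (Cle _)) // -ler_pdivlMl //.
Qed.

Lemma ip_cvg0 (u : nat -> 'rV[R]_d) v :
  ip (u n - v) (u n - v) @[n --> \oo] --> 0 -> u n @[n --> \oo] --> v.
Proof.
move=> h; apply: nrm_cvg; rewrite -(sqrtr0 R).
exact: (continuous_cvg _ (@sqrt_continuous R 0)).
Qed.

Lemma nrm_cauchy (u : nat -> 'rV[R]_d) :
  (forall e, 0 < e -> exists N, forall n m, (N <= n)%N -> (N <= m)%N ->
     nrm (u n - u m) <= e) -> cvg (u n @[n --> \oo]).
Proof.
move=> h; have [C C0 Cle] := norm_le_nrm.
apply/cauchy_cvgP/cauchy_exP => e e0.
have [|N hN] := h (C^-1 * (e / 2)).
  by rewrite mulr_gt0 ?invr_gt0 // divr_gt0.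
exists (u N); exists N => // n /= Nn.
rewrite -ball_normE /ball_ /= (le_lt_trans (Cle _)) //.
rewrite (@le_lt_trans _ _ (e / 2)) ?ltr_pdivrMr ?ltr_pMr ?ltr1n //.
by rewrite -ler_pdivlMl ?hN.
Qed.

(** The increments of [u] are dominated by those of the partial sums of [b]. *)
Lemma nrm_summable_cvg (u : nat -> 'rV[R]_d) (b : nat -> R) :
  (forall n, nrm (u n.+1 - u n) <= b n) -> cvgn (series b) ->
  cvg (u n @[n --> \oo]).
Proof.
move=> ub /cvg_ex[/= l bl]; apply: nrm_cauchy => e e0.
have e20 : 0 < e / 2 by rewrite divr_gt0.
have /cvgrPdist_le/(_ _ e20)[N _ NP] := bl.
have le n m : (n <= m)%N -> nrm (u m - u n) <= series b m - series b n.
  elim: m => [|m IH]; first by rewrite leqn0 => /eqP ->; rewrite !subrr nrm0.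
  rewrite leq_eqVlt => /orP[/eqP ->|nm]; first by rewrite !subrr nrm0.
  rewrite -(subrKA (u m)) (le_trans (nrmD _ _)) //.
  have -> : series b m.+1 = series b m + b m by rewrite !seriesEnat /= big_nat_recr.
  by have := IH nm; have := ub m; lra.
suff : forall n m, (N <= n)%N -> (n <= m)%N -> nrm (u m - u n) <= e.
  move=> h; exists N => n m Nn Nm; have [nm|/ltnW mn] := leqP n m.
    by rewrite -nrmN opprB h.
  exact: h.
move=> n m Nn nm; have := NP n Nn; have := NP m (leq_trans Nn nm).
have := le _ _ nm; have := ler_norm (l - series b n).
have := ler_norm (- (l - series b m)).
rewrite normrN /=; lra.
Qed.

End InnerProduct.

(** * Integrals of nonnegative functions *)

Section RealIntegral.
Context {dT : measure_display} {T : measurableType dT} {R : realType}.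
Variable mu : {measure set T -> \bar R}.
Implicit Types f g : T -> R.

(** Real-valued integrands with extended-valued integrals: nonnegative functions
    can then be added and compared without integrability conditions. *)
Definition eintegral f : \bar R := (\int[mu]_x (f x)%:E)%E.

Lemma eintegral_ge0 f : (forall x, 0 <= f x) -> (0 <= eintegral f)%E.
Proof. by move=> f0; apply: integral_ge0 => x _; rewrite lee_fin. Qed.

Lemma le_eintegral f g : measurable_fun setT f -> measurable_fun setT g ->
  (forall x, 0 <= f x) -> (forall x, f x <= g x) -> (eintegral f <= eintegral g)%E.
Proof.
move=> mf mg f0 fg; apply: ge0_le_integral => //.
- by move=> x _; rewrite lee_fin.
- exact/measurable_EFinP.
- exact/measurable_EFinP.
- by move=> x _; rewrite lee_fin.
Qed.

Lemma eintegralD f g : measurable_fun setT f -> measurable_fun setT g ->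
  (forall x, 0 <= f x) -> (forall x, 0 <= g x) ->
  eintegral (fun x => f x + g x) = (eintegral f + eintegral g)%E.
Proof.
move=> mf mg f0 g0; rewrite /eintegral; under eq_integral do rewrite EFinD.
by apply: ge0_integralD => //; try exact/measurable_EFinP; move=> x _; rewrite lee_fin.
Qed.

Lemma eintegralZ k f : measurable_fun setT f -> (forall x, 0 <= f x) -> 0 <= k ->
  eintegral (fun x => k * f x) = (k%:E * eintegral f)%E.
Proof.
move=> mf f0 k0; rewrite /eintegral; under eq_integral do rewrite EFinM.
by apply: ge0_integralZl => //; try exact/measurable_EFinP; move=> x _; rewrite lee_fin.
Qed.

Lemma eintegral0 : eintegral (fun=> 0) = 0%E.
Proof. exact: integral0. Qed.

Lemma eintegral_indic (A : set T) : measurable A -> eintegral (\1_A) = mu A.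
Proof. by move=> mA; rewrite /eintegral integral_indic // setIT. Qed.

Lemma eintegral_sum n (f : nat -> T -> R) : (forall i, measurable_fun setT (f i)) ->
  (forall i x, 0 <= f i x) ->
  eintegral (fun x => \sum_(0 <= i < n) f i x) = (\sum_(0 <= i < n) eintegral (f i))%E.
Proof.
move=> mf f0; rewrite /eintegral; under eq_integral do rewrite -sumEFin.
by rewrite ge0_integral_sum // => [i|i x _]; rewrite ?lee_fin //; exact/measurable_EFinP.
Qed.

Lemma eintegral_eq0_ae f : measurable_fun setT f -> (forall x, 0 <= f x) ->
  eintegral f = 0%E -> {ae mu, forall x, f x = 0}.
Proof.
move=> mf f0 If.
have mEf : measurable_fun setT (fun x => (f x)%:E) by exact/measurable_EFinP.
have /(ae_eq_integral_abs mu measurableT mEf) : (\int[mu]_x `|(f x)%:E| = 0)%E.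
  by rewrite -If; apply: eq_integral => x _; rewrite gee0_abs // lee_fin.
by apply: filterS => x /(_ I) [].
Qed.

Lemma ae_eq_eintegral f g : measurable_fun setT f -> measurable_fun setT g ->
  (forall x, 0 <= f x) -> (forall x, 0 <= g x) ->
  {ae mu, forall x, f x = g x} -> eintegral f = eintegral g.
Proof.
move=> mf mg f0 g0 fg; apply: ge0_ae_eq_integral => //.
- exact/measurable_EFinP.
- exact/measurable_EFinP.
- by move=> x _; rewrite lee_fin.
- by move=> x _; rewrite lee_fin.
- by apply: filterS fg => x -> _.
Qed.

End RealIntegral.

Section Fatou.
Context {dT : measure_display} {T : measurableType dT} {R : realType}.
Variable mu : {measure set T -> \bar R}.

Lemma limn_einf_le (u : nat -> \bar R) (r : \bar R) :
  (\forall n \near \oo, (u n <= r)%E) -> (limn_einf u <= r)%E.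
Proof.
move=> [N _ ur]; rewrite limn_einf_lim; apply: lime_le; first exact: is_cvg_einfs.
apply: nearW => n; apply: le_trans (ur (maxn n N) _); last exact: leq_maxr.
by apply: ereal_inf_lbound; exists (maxn n N) => //=; exact: leq_maxl.
Qed.

(** Fatou's lemma, for a convergent sequence with eventually bounded integrals. *)
Lemma eintegral_cvg_le (f : nat -> T -> R) (g : T -> R) (r : \bar R) :
  (forall n, measurable_fun setT (f n)) -> (forall n x, 0 <= f n x) ->
  (forall x, f n x @[n --> \oo] --> g x) ->
  (\forall n \near \oo, (eintegral mu (f n) <= r)%E) -> (eintegral mu g <= r)%E.
Proof.
move=> mf f0 fg fr; apply: le_trans (limn_einf_le fr).
have mEf n : measurable_fun setT (fun x => (f n x)%:E) by exact/measurable_EFinP.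
have f0' n x : setT x -> (0 <= (f n x)%:E)%E by rewrite lee_fin.
apply: le_trans (fatou mu measurableT mEf f0').
rewrite le_eqVlt; apply/orP; left; apply/eqP; apply: eq_integral => x _.
have efg : (fun n => (f n x)%:E) @ \oo --> (g x)%:E.
  by apply: cvg_EFin; [exact: nearW|exact: fg].
by rewrite (cvg_limn_einf_sup efg).1.
Qed.

End Fatou.

Section AEFinite.
Context {dT : measure_display} {T : measurableType dT} {R : realType}.
Variable mu : {measure set T -> \bar R}.

(** The sum of the series has an integral of at most [M], so it is finite almost
    everywhere.  The exceptional set is returned as an explicit measurable set
    because functions are later modified on it. *)
Lemma ae_bounded_series (f : nat -> T -> R) (a : nat -> R) (M : R) :
  (forall n, measurable_fun setT (f n)) -> (forall n x, 0 <= f n x) ->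
  (forall n, (eintegral mu (f n) <= (a n)%:E)%E) ->
  (forall n, \sum_(0 <= i < n) a i <= M) ->
  exists Z : set T, [/\ measurable Z, mu (~` Z) = 0%E &
    forall x, Z x -> cvgn (series (f^~ x))].
Proof.
move=> mf f0 fa aM.
have mEf n : measurable_fun setT (fun x => (f n x)%:E) by exact/measurable_EFinP.
have f0' n x : setT x -> (0 <= (f n x)%:E)%E by rewrite lee_fin.
pose G x := (\sum_(n <oo) (f n x)%:E)%E.
have mG : measurable_fun setT G.
  by apply: ge0_emeasurable_sum => // n x _ _; rewrite lee_fin.
have G0 x : (0 <= G x)%E by apply: nneseries_ge0 => n _ _; rewrite lee_fin.
have GM : (\int[mu]_x G x <= M%:E)%E.
  rewrite integral_nneseries //; apply: lime_le.
    by apply: is_cvg_nneseries => n _ _; exact: eintegral_ge0.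
  apply: nearW => n; rewrite (@le_trans _ _ (\sum_(0 <= i < n) (a i)%:E)%E) //.
    by apply: lee_sum => i _; exact: fa.
  by rewrite sumEFin lee_fin.
have iG : mu.-integrable setT G.
  apply/integrableP; split => //.
  under eq_integral do rewrite gee0_abs //.
  by rewrite (le_lt_trans GM) ?ltry.
exists [set x | G x \is a fin_num]; split.
- by have := emeasurable_fin_num measurableT mG; rewrite setTI.
- have [N [mN N0 sN]] := integrable_ae measurableT iG.
  apply/negligibleP.
    by apply: measurableC; have := emeasurable_fin_num measurableT mG; rewrite setTI.
  by exists N; split => // x /= nx; apply: sN => /= /(_ I).
move=> x /= Gx; apply: nondecreasing_is_cvgn.
  by apply/nondecreasing_seqP => n; rewrite !seriesEnat /= big_nat_recr //= lerDl.
exists (fine (G x)) => _ [n _ <-].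
rewrite -lee_fin fineK // seriesEnat /= -sumEFin.
by apply: nneseries_lim_ge => i _ _; rewrite lee_fin.
Qed.

End AEFinite.

(** * The maximal ergodic inequality *)

Section MaximalErgodic.
Context {dT : measure_display} {T : measurableType dT} {R : realType}.
Variables (mu : probability T R) (tau : T -> T).
Hypothesis mtau : measurable_fun setT tau.
Hypothesis tau_mu : forall B, measurable B -> mu (tau @^-1` B) = mu B.

Lemma measurable_iter n : measurable_fun setT (iter n tau).
Proof.
by elim: n => [|n IH]; [exact: measurable_id|exact: measurableT_comp].
Qed.

Lemma eintegral_comp (f : T -> R) : measurable_fun setT f -> (forall x, 0 <= f x) ->
  eintegral mu (f \o tau) = eintegral mu f.
Proof.
move=> mf f0; rewrite /eintegral.
have mEf : measurable_fun setT (EFin \o f) by exact/measurable_EFinP.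
have -> : (\int[mu]_x (f x)%:E = \int[pushforward mu tau]_x (f x)%:E)%E.
  by apply: eq_measure_integral => A mA _; rewrite -[LHS](tau_mu mA).
rewrite (@ge0_integral_pushforward _ _ _ _ _ tau mtau mu setT (EFin \o f)) //.
by move=> x _; rewrite lee_fin.
Qed.

Lemma eintegral_iter n (f : T -> R) : measurable_fun setT f -> (forall x, 0 <= f x) ->
  eintegral mu (f \o iter n tau) = eintegral mu f.
Proof.
elim: n f => [//|n IH] f mf f0.
rewrite -[RHS]eintegral_comp // -[RHS]IH //; first exact: measurableT_comp.
by move=> x; exact: f0.
Qed.

Section Maximal.
Variables (u : T -> R) (l : R).
Hypotheses (mu_u : measurable_fun setT u) (u0 : forall x, 0 <= u x) (l0 : 0 < l).

(** The maximum over k <= n of the sums over i < k of (u (tau^i x) - l), empty sum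
    included.  The recursion exhibits the identity
    excess n.+1 = u - l + excess n o tau on the set where the left side is
    positive. *)
Fixpoint excess n x : R :=
  if n is m.+1 then Num.max 0 (u x - l + excess m (tau x)) else 0.

Lemma measurable_excess n : measurable_fun setT (excess n).
Proof.
elim: n => [|n IH] /=; first exact: measurable_cst.
apply: measurable_maxr; first exact: measurable_cst.
apply: measurable_funD; first by apply: measurable_funB.
exact: (measurableT_comp IH mtau).
Qed.

Lemma measurable_excess_gt0 n : measurable [set x | 0 < excess n x].
Proof.
have := measurable_fun_ltr (measurable_cst (0 : R)) (measurable_excess n).
move=> /(_ measurableT [set true] I); rewrite setTI.
by rewrite (_ : _ @^-1` _ = [set x | 0 < excess n x]).
Qed.

Lemma excess_ge0 n x : 0 <= excess n x.
Proof. by case: n => //= n; rewrite le_max lexx. Qed.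

Lemma excess_nondecreasing n x : excess n x <= excess n.+1 x.
Proof.
elim: n x => [|n IH] x; first exact: excess_ge0.
rewrite /= ge_max le_max lexx /= le_max; apply/orP; right.
by rewrite lerD2l; exact: IH.
Qed.

Lemma sum_le_excess n x :
  \sum_(0 <= i < n) u (iter i tau x) - n%:R * l <= excess n x.
Proof.
elim: n x => [|n IH] x; first by rewrite big_geq // mul0r subr0.
rewrite big_nat_recl //= le_max; apply/orP; right.
under eq_bigr do rewrite -iterS iterSr.
have := IH (tau x); rewrite -natr1 mulrDl mul1r; lra.
Qed.

(** Garsia's argument.  Where [excess n.+1] is positive it equals
    u - l + excess n o tau, so that everywhere
    excess n.+1 + l * 1_E <= u + excess n o tau, with E the set of positivity.
    Integrate, use the invariance of the measure and the monotonicity in n, and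
    cancel the finite integral of [excess n.+1]. *)
Lemma excess_measure n : (eintegral mu u < +oo)%E ->
  (l%:E * mu [set x | (0 < excess n x)%R] <= eintegral mu u)%E.
Proof.
move=> uoo.
have mtE k : measurable_fun setT (excess k \o tau).
  by apply: measurableT_comp => //; exact: measurable_excess.
have ME := measurable_excess.
case: n => [|n].
  rewrite (_ : mkset _ = set0) ?measure0 ?mule0 ?eintegral_ge0 //.
  by apply/seteqP; split => x //=; rewrite ltxx.
have fin k : (eintegral mu (excess k) < +oo)%E.
  elim: k => [|k IH]; first by rewrite eintegral0.
  apply: (@le_lt_trans _ _ (eintegral mu (fun x => u x + (excess k \o tau) x))).
    apply: le_eintegral => //; first exact: measurable_funD.
      by move=> x; exact: excess_ge0.
    move=> x /=; rewrite ge_max addr_ge0 ?excess_ge0 //=.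
    by rewrite lerD2r gerBl ltW.
  rewrite eintegralD //; last by move=> x; exact: excess_ge0.
  rewrite eintegral_comp //; last by move=> x; exact: excess_ge0.
  exact: lte_add_pinfty.
set E := [set x | _].
have mE : measurable E by exact: measurable_excess_gt0.
have m1 : measurable_fun setT (fun x => l * \1_E x).
  by apply: measurable_funM; [exact: measurable_cst|exact: measurable_indic].
have key : (eintegral mu (fun x => excess n.+1 x + l * \1_E x)%R <=
            eintegral mu (fun x => u x + (excess n \o tau) x)%R)%E.
  apply: le_eintegral => //.
  - exact: measurable_funD.
  - exact: measurable_funD.
  - by move=> x; rewrite addr_ge0 ?excess_ge0 // mulr_ge0 // ltW.
  - move=> x /=; rewrite indicE; have [xE|xE] := boolP (x \in E).
      move: xE; rewrite inE /E /= lt_max ltxx /= => h.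
      by rewrite mulr1 max_r ?(ltW h) //; lra.
    rewrite mulr0 addr0; have -> : Num.max 0 (u x - l + excess n (tau x)) = 0.
      rewrite -/(excess n.+1 x); apply/eqP; rewrite eq_le.
      by rewrite excess_ge0 andbT leNgt; apply: contra xE => h; rewrite inE.
    by rewrite addr_ge0 ?excess_ge0.
move: key; rewrite eintegralD //; last 2 first.
- by move=> x; exact: excess_ge0.
- by move=> x; rewrite mulr_ge0 // ltW.
rewrite (eintegralZ _ _ _ (ltW l0)) //.
rewrite eintegral_indic // eintegralD //; last by move=> x; exact: excess_ge0.
rewrite eintegral_comp //; last by move=> x; exact: excess_ge0.
move=> key.
have : (eintegral mu (excess n.+1) + l%:E * mu E <=
        eintegral mu (excess n.+1) + eintegral mu u)%E.
  apply: (le_trans key); rewrite addeC leeD2r //.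
  by apply: le_eintegral => //; [exact: excess_ge0|exact: excess_nondecreasing].
by rewrite leeD2lE // ge0_fin_numE ?eintegral_ge0 //; exact: excess_ge0.
Qed.

Lemma maximal_ergodic : (eintegral mu u < +oo)%E ->
  exists B, [/\ measurable B, (l%:E * mu B <= eintegral mu u)%E &
    forall x, ~ B x -> forall n, \sum_(0 <= i < n) u (iter i tau x) <= n%:R * l].
Proof.
move=> uoo; pose F n := [set x | 0 < excess n x].
have mF n : measurable (F n) by exact: measurable_excess_gt0.
have mB : measurable (\bigcup_n F n) by exact: bigcup_measurable.
exists (\bigcup_n F n); split => //.
  have ndF : nondecreasing_seq F.
    apply/nondecreasing_seqP => n; apply/subsetPset => x /= h.
    exact: lt_le_trans h (excess_nondecreasing n x).
  have cF := nondecreasing_cvg_mu (mu := mu) mF mB ndF.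
  have : (l%:E * mu (F n))%E @[n --> \oo] --> (l%:E * mu (\bigcup_n F n))%E.
    by apply: cvgeZl.
  move=> /cvg_lim <- //.
  apply: lime_le; first by apply/cvg_ex; eexists; apply: cvgeZl => //; exact: cF.
  by apply: nearW => n; exact: excess_measure.
move=> x Bx n; have := sum_le_excess n x.
have -> : excess n x = 0.
  apply/eqP; rewrite eq_le excess_ge0 andbT leNgt; apply/negP => h.
  by apply: Bx; exists n.
by rewrite subr_le0.
Qed.

End Maximal.

(** Borel-Cantelli without summability: for each [k] the points that are
    exceptional for every [m] lie in sets of arbitrarily small measure. *)
Lemma maximal_ae (v : nat -> T -> R) :
  (forall m, measurable_fun setT (v m)) -> (forall m x, 0 <= v m x) ->
  eintegral mu (v m) @[m --> \oo] --> 0%E ->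
  {ae mu, forall x, forall k, exists m, forall n,
    \sum_(0 <= i < n) v m (iter i tau x) <= n%:R * k.+1%:R^-1}.
Proof.
move=> mv v0 cv.
apply: ae_foralln => k.
have k0 : 0 < k.+1%:R^-1 :> R by rewrite invr_gt0.
have BP m : exists B, measurable B /\ ((eintegral mu (v m) < +oo)%E ->
    ((k.+1%:R^-1)%:E * mu B <= eintegral mu (v m))%E /\
    forall x, ~ B x -> forall n,
      \sum_(0 <= i < n) v m (iter i tau x) <= n%:R * k.+1%:R^-1).
  have [voo|voo] := pselect (eintegral mu (v m) < +oo)%E; last by exists set0; split.
  by have [B [mB B1 B2]] := maximal_ergodic (mv m) (v0 m) k0 voo; exists B.
have /choice[B BE] := BP.
have fin : \forall m \near \oo, (eintegral mu (v m) < +oo)%E.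
  have := cv; move=> /fine_cvgP[+ _]; apply: filterS => m.
  by rewrite fin_numElt => /andP[].
(* If [v m] has an infinite integral the maximal inequality excludes no point. *)
pose B' m := if (eintegral mu (v m) < +oo)%E then B m else setT.
have mB' m : measurable (B' m).
  by rewrite /B'; case: ifP => // _; have [] := BE m.
exists (\bigcap_m B' m); split.
- exact: bigcapT_measurable.
- apply/eqP; rewrite eq_le measure_ge0 andbT.
  have : ((k.+1%:R)%:E * eintegral mu (v m))%E @[m --> \oo] --> 0%E.
    rewrite -(mule0 k.+1%:R%:E); exact: cvgeZl.
  move=> h; rewrite -(cvg_lim _ h) //.
  apply: lime_ge; first by apply/cvg_ex; eexists; exact: h.
  apply: filterS fin => m vm.
  have [_ /(_ vm)[+ _]] := BE m => le1.
  apply: (@le_trans _ _ (mu (B m))).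
    apply: le_measure; rewrite ?inE //; first exact: bigcapT_measurable.
      by have [] := BE m.
    by move=> x /(_ m I); rewrite /B' vm.
  apply: le_trans (_ : (k.+1%:R%:E * ((k.+1%:R^-1)%:E * mu (B m)) <= _)%E).
    by rewrite muleA -EFinM mulfV ?pnatr_eq0 // mul1e.
  by rewrite lee_pmul2l.
- move=> x /= nP m _; rewrite /B'; case: ifP => // vm; apply: contrapT => Bx.
  by apply: nP; exists m; have [_ /(_ vm)[_]] := BE m; apply.
Qed.

End MaximalErgodic.

(** * Square-integrable vector-valued functions *)

Section SquareIntegrable.
Context {dT : measure_display} {T : measurableType dT} {R : realType} {d : nat}.
Variables (mu : probability T R) (ip : 'rV[R]_d -> 'rV[R]_d -> R).
Hypothesis ip_scalar : scalar_product ip.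
Implicit Types f g h : T -> 'rV[R]_d.

(** Equivalent to Borel measurability (see [coord_measurableP]), and immediately
    stable under linear operations. *)
Definition coord_measurable f :=
  forall i, measurable_fun setT (fun x => f x 0 i).

Lemma coord_measurableD f g : coord_measurable f -> coord_measurable g ->
  coord_measurable (fun x => f x + g x).
Proof.
move=> mf mg i; rewrite (_ : (fun x => _) = (fun x => f x 0 i) \+ (fun x => g x 0 i)).
  exact: measurable_funD.
by apply/funext => x; rewrite mxE.
Qed.

Lemma coord_measurableZ a f : coord_measurable f ->
  coord_measurable (fun x => a *: f x).
Proof.
move=> mf i; rewrite (_ : (fun x => _) = (fun x => a * f x 0 i)).
  by apply: measurable_funM => //; exact: measurable_cst.
by apply/funext => x; rewrite mxE.
Qed.

Lemma coord_measurableN f : coord_measurable f -> coord_measurable (fun x => - f x).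
Proof.
move=> mf; rewrite (_ : (fun x => _) = (fun x => -1 *: f x)).
  exact: coord_measurableZ.
by apply/funext => x; rewrite scaleN1r.
Qed.

Lemma coord_measurableB f g : coord_measurable f -> coord_measurable g ->
  coord_measurable (fun x => f x - g x).
Proof. by move=> mf mg; apply: coord_measurableD => //; exact: coord_measurableN. Qed.

Lemma coord_measurable_sum n (f : nat -> T -> 'rV[R]_d) :
  (forall i, coord_measurable (f i)) ->
  coord_measurable (fun x => \sum_(0 <= i < n) f i x).
Proof.
move=> mf i; rewrite (_ : (fun x => _) = (fun x => \sum_(0 <= k < n) f k x 0 i)).
  by apply: measurable_sum => k; exact: mf.
by apply/funext => x; rewrite summxE.
Qed.

Lemma measurable_ip f g : coord_measurable f -> coord_measurable g ->
  measurable_fun setT (fun x => ip (f x) (g x)).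
Proof.
move=> mf mg; rewrite (_ : (fun x => _) = (fun x => \sum_i \sum_j f x 0 i * g x 0 j *
  ip (delta_mx 0 i) (delta_mx 0 j))); last first.
  by apply/funext => x; rewrite (ip_coordE ip_scalar).
apply: measurable_sum => i; apply: measurable_sum => j.
by apply: measurable_funM; [exact: measurable_funM|exact: measurable_cst].
Qed.

(** The square of the L^2 norm; it is additive in the integrand, while the norm is
    not, so all estimates below are made on squares. *)
Definition esqnorm f : \bar R := eintegral mu (fun x => ip (f x) (f x)).
Local Notation esq := esqnorm.

Definition sqnorm f : R := fine (esq f).

Local Notation sq := sqnorm.
Definition sq_integrable f := coord_measurable f /\ (esq f < +oo)%E.

Local Notation L2 := sq_integrable.

Lemma esq_ge0 f : (0 <= esq f)%E.
Proof. by apply: eintegral_ge0 => x; exact: ip_ge0. Qed.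

Lemma sq_ge0 f : 0 <= sq f.
Proof. exact/fine_ge0/esq_ge0. Qed.

Lemma sqE f : L2 f -> esq f = (sq f)%:E.
Proof. by move=> [_ foo]; rewrite fineK // ge0_fin_numE // esq_ge0. Qed.

Lemma esq_le f r : 0 <= r -> (esq f <= r%:E)%E -> sq f <= r.
Proof.
move=> r0 fr; rewrite -lee_fin fineK // ge0_fin_numE ?esq_ge0 //.
by rewrite (le_lt_trans fr) ?ltry.
Qed.

Lemma le_esq f g h a b : coord_measurable f -> coord_measurable g ->
  coord_measurable h -> 0 <= a -> 0 <= b ->
  (forall x, ip (f x) (f x) <= a * ip (g x) (g x) + b * ip (h x) (h x)) ->
  (esq f <= a%:E * esq g + b%:E * esq h)%E.
Proof.
move=> mf mg mh a0 b0 fgh.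
have mg' : measurable_fun setT (fun x => a * ip (g x) (g x)).
  by apply: measurable_funM; [exact: measurable_cst|exact: measurable_ip].
have mh' : measurable_fun setT (fun x => b * ip (h x) (h x)).
  by apply: measurable_funM; [exact: measurable_cst|exact: measurable_ip].
have g0 x : 0 <= ip (g x) (g x) by exact: ip_ge0.
have h0 x : 0 <= ip (h x) (h x) by exact: ip_ge0.
have f0 x : 0 <= ip (f x) (f x) by exact: ip_ge0.
rewrite /esqnorm -!eintegralZ //; try exact: measurable_ip.
rewrite -eintegralD //; try by move=> x; rewrite mulr_ge0.
by apply: le_eintegral => //; [exact: measurable_ip|exact: measurable_funD].
Qed.

Lemma sqD_le t f g : 0 < t -> L2 f -> L2 g ->
  L2 (fun x => f x + g x) /\
  sq (fun x => f x + g x) <= (1 + t) * sq f + (1 + t^-1) * sq g.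
Proof.
move=> t0 Lf Lg; have mfg := coord_measurableD Lf.1 Lg.1.
have t1 : 0 <= 1 + t by rewrite addr_ge0 // ltW.
have t2 : 0 <= 1 + t^-1 by rewrite addr_ge0 // invr_ge0 ltW.
have : (esq (fun x => (f x + g x)%R) <=
    (1 + t)%:E * esq f + (1 + t^-1)%:E * esq g)%E.
  by apply: le_esq => //; [exact: Lf.1|exact: Lg.1|move=> x; exact: ipD_le].
rewrite (sqE Lf) (sqE Lg) -!EFinM -EFinD => h; split.
  by split => //; rewrite (le_lt_trans h) ?ltry.
by apply: esq_le => //; rewrite addr_ge0 // mulr_ge0 // sq_ge0.
Qed.

Lemma L2D f g : L2 f -> L2 g -> L2 (fun x => f x + g x).
Proof. by move=> Lf Lg; have [] := sqD_le ltr01 Lf Lg. Qed.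

Lemma L2Z a f : L2 f -> L2 (fun x => a *: f x).
Proof.
move=> Lf; split; first exact: coord_measurableZ Lf.1.
have : (esq (fun x => (a *: f x)%R) <= (a ^+ 2)%:E * esq f + 0%:E * esq f)%E.
  apply: le_esq => //; try exact: Lf.1; first exact: coord_measurableZ Lf.1.
    exact: sqr_ge0.
  by move=> x; rewrite ipZZ // mul0r addr0.
by rewrite (sqE Lf) mul0e adde0 => /le_lt_trans; apply; rewrite ltry.
Qed.

Lemma L2N f : L2 f -> L2 (fun x => - f x).
Proof.
by move=> /(L2Z (-1)); congr L2; apply/funext => x; rewrite scaleN1r.
Qed.

Lemma L2B f g : L2 f -> L2 g -> L2 (fun x => f x - g x).
Proof. by move=> Lf /L2N; exact: L2D. Qed.

Lemma L2_0 : L2 (fun=> 0).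
Proof.
split; first by move=> i; exact: measurable_cst.
rewrite /esqnorm (_ : (fun _ => _) = (fun=> 0)) ?eintegral0 //.
by apply/funext => x; rewrite ip0l.
Qed.

Lemma sq0 : sq (fun=> 0) = 0.
Proof.
rewrite /sqnorm /esqnorm (_ : (fun _ => _) = (fun=> 0)) ?eintegral0 //.
by apply/funext => x; rewrite ip0l.
Qed.

Lemma L2_sum n (f : nat -> T -> 'rV[R]_d) : (forall i, L2 (f i)) ->
  L2 (fun x => \sum_(0 <= i < n) f i x).
Proof.
move=> Lf; elim: n => [|n IH].
  rewrite (_ : (fun x => _) = (fun=> 0)); first exact: L2_0.
  by apply/funext => x; rewrite big_geq.
rewrite (_ : (fun x => _) = (fun x => \sum_(0 <= i < n) f i x + f n x)).
  exact: L2D.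
by apply/funext => x; rewrite big_nat_recr.
Qed.

Lemma sqZ a f : L2 f -> sq (fun x => a *: f x) = a ^+ 2 * sq f.
Proof.
move=> Lf; apply: EFin_inj; rewrite -sqE; last exact: L2Z.
rewrite EFinM -sqE // /esqnorm -eintegralZ ?sqr_ge0 //.
- by congr eintegral; apply/funext => x; rewrite ipZZ.
- exact: measurable_ip Lf.1 Lf.1.
- by move=> x; exact: ip_ge0.
Qed.

Lemma sqN f : sq (fun x => - f x) = sq f.
Proof.
rewrite /sqnorm /esqnorm; congr (fine (eintegral _ _)).
by apply/funext => x; rewrite ipNN.
Qed.

Lemma sqBC f g : sq (fun x => f x - g x) = sq (fun x => g x - f x).
Proof.
by rewrite -sqN; congr sq; apply/funext => x; rewrite opprB.
Qed.

Lemma sqB_le2 f g : L2 f -> L2 g ->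
  sq (fun x => f x - g x) <= 2 * sq f + 2 * sq g.
Proof.
move=> Lf Lg; have [_] := sqD_le ltr01 Lf (L2N Lg).
by rewrite sqN invr1.
Qed.

Lemma sqB_triangle2 f g h : L2 f -> L2 g -> L2 h ->
  sq (fun x => f x - h x) <=
  2 * sq (fun x => f x - g x) + 2 * sq (fun x => g x - h x).
Proof.
move=> Lf Lg Lh; have [_] := sqD_le ltr01 (L2B Lf Lg) (L2B Lg Lh).
rewrite invr1 (_ : (fun x => _ + _) = (fun x => f x - h x)) //.
by apply/funext => x; rewrite subrKA.
Qed.

Lemma sq_parallelogram f g : L2 f -> L2 g ->
  sq (fun x => f x - g x) + 4 * sq (fun x => 2^-1 *: (f x + g x)) =
  2 * sq f + 2 * sq g.
Proof.
move=> Lf Lg; apply: EFin_inj.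
have Lfg := L2B Lf Lg; have Lm := L2Z 2^-1 (L2D Lf Lg).
rewrite !EFinD !EFinM -!sqE // /esqnorm -!eintegralZ //;
  try (by move=> x; exact: ip_ge0); try (by apply: measurable_ip; apply: proj1; eassumption).
rewrite -!eintegralD //; try (by move=> x; rewrite ?mulr_ge0 ?ip_ge0);
  try (by apply: measurable_ip; apply: proj1; eassumption);
  try (by apply: measurable_funM; [exact: measurable_cst|
          apply: measurable_ip; apply: proj1; eassumption]).
by congr eintegral; apply/funext => x; exact: ip_parallelogram.
Qed.

Lemma sq_eq0_ae f : L2 f -> sq f = 0 -> {ae mu, forall x, f x = 0}.
Proof.
move=> Lf f0.
have : {ae mu, forall x, ip (f x) (f x) = 0}.
  apply: eintegral_eq0_ae; first exact: measurable_ip Lf.1 Lf.1.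
    by move=> x; exact: ip_ge0.
  by rewrite -/(esq f) sqE // f0.
by apply: filterS => x; exact: ip_eq0.
Qed.

Lemma ae_eq_sq f g : coord_measurable f -> coord_measurable g ->
  {ae mu, forall x, f x = g x} -> sq f = sq g.
Proof.
move=> mf mg fg; rewrite /sqnorm /esqnorm; congr fine; apply: ae_eq_eintegral.
- exact: measurable_ip.
- exact: measurable_ip.
- by move=> x; exact: ip_ge0.
- by move=> x; exact: ip_ge0.
- by apply: filterS fg => x ->.
Qed.

End SquareIntegrable.

Section Completeness.
Context {dT : measure_display} {T : measurableType dT} {R : realType} {d : nat}.
Variables (mu : probability T R) (ip : 'rV[R]_d -> 'rV[R]_d -> R).
Hypothesis ip_scalar : scalar_product ip.

Local Notation sq := (sqnorm mu ip).
Local Notation L2 := (sq_integrable mu ip).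

(** Partial sums of the Cauchy moduli, so that the indices are nondecreasing and
    each one is beyond all the earlier moduli. *)
Lemma rapid_subsequence (u : nat -> T -> 'rV[R]_d) (c : nat -> R) :
  (forall j, 0 < c j) ->
  (forall e, 0 < e -> exists N, forall n m, (N <= n)%N -> (N <= m)%N ->
    sq (fun x => u n x - u m x) <= e) ->
  exists2 s : nat -> nat, (forall j, s j <= s j.+1)%N &
    forall j k, (j <= k)%N -> forall n, (s j <= n)%N ->
    sq (fun x => u n x - u (s k) x) <= c j.
Proof.
move=> c0 cu.
have /choice[N NE] : forall j, exists N, forall n m, (N <= n)%N -> (N <= m)%N ->
    sq (fun x => u n x - u m x) <= c j by move=> j; exact: cu.
exists (fun j => \sum_(0 <= i < j.+1) N i)%N => [j|j k jk n jn].
  by rewrite [leqRHS]big_nat_recr //= leq_addr.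
have Nj i : (j <= i)%N -> (N j <= \sum_(0 <= i < i.+1) N i)%N.
  elim: i => [|i IH]; first by rewrite leqn0 => /eqP ->; rewrite big_nat1.
  rewrite leq_eqVlt big_nat_recr //= => /orP[/eqP ->|/IH]; first exact: leq_addl.
  by move=> /leq_trans; apply; exact: leq_addr.
by apply: NE; [exact: leq_trans (Nj _ (leqnn _)) jn|exact: Nj].
Qed.

(** Riesz-Fischer.  Along a subsequence with increments [w j] such that
    sq (w j) <= 4^-j, the arithmetic-geometric inequality gives
    |w j| <= 2^j |w j|^2 + 2^-j, whose sum has a finite integral; hence the
    subsequence converges almost everywhere, and Fatou's lemma bounds the distance
    to the limit. *)
Lemma L2_complete (u : nat -> T -> 'rV[R]_d) : (forall n, L2 (u n)) ->
  (forall e, 0 < e -> exists N, forall n m, (N <= n)%N -> (N <= m)%N ->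
    sq (fun x => u n x - u m x) <= e) ->
  exists2 h, L2 h & sq (fun x => u n x - h x) @[n --> \oo] --> 0.
Proof.
move=> Lu cu.
pose c (j : nat) : R := 2^-1 ^+ j * 2^-1 ^+ j.
have c0 j : 0 < c j by rewrite mulr_gt0 // exprn_gt0.
have [s s_mono sP] := rapid_subsequence c0 cu.
pose w j x := u (s j.+1) x - u (s j) x.
have Lw j : L2 (w j) by exact: L2B.
pose b j x := 2 ^+ j * ip (w j x) (w j x) + 2^-1 ^+ j.
have iw0 j x : 0 <= ip (w j x) (w j x) by exact: ip_ge0.
have mb1 j : measurable_fun setT (fun x => 2 ^+ j * ip (w j x) (w j x)).
  apply: measurable_funM; first exact: measurable_cst.
  by apply: measurable_ip => //; exact: (Lw j).1.
have b1 j x : 0 <= 2 ^+ j * ip (w j x) (w j x) by rewrite mulr_ge0 // exprn_ge0.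
have b2 j : 0 <= 2^-1 ^+ j :> R by rewrite exprn_ge0.
have [||||Z [mZ Z0 Zcvg]] := @ae_bounded_series _ _ _ mu b (fun j => 2 * 2^-1 ^+ j) 4.
- by move=> j; apply: measurable_funD => //; exact: measurable_cst.
- by move=> j x; rewrite addr_ge0.
- move=> j; have mw := measurable_ip ip_scalar (Lw j).1 (Lw j).1.
  rewrite /b (eintegralD _ (mb1 j) (measurable_cst _)) //; last by move=> x; exact: b2.
  rewrite (_ : eintegral mu (fun x => 2 ^+ j * _) = ((2 ^+ j)%:E * esqnorm mu ip (w j))%E);
    last by apply: eintegralZ => //; rewrite exprn_ge0.
  rewrite (sqE ip_scalar (Lw j)).
  rewrite (_ : eintegral mu (fun=> 2^-1 ^+ j) = (2^-1 ^+ j)%:E); last first.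
    rewrite /eintegral (integral_cst mu measurableT (2^-1 ^+ j)%:E).
    by rewrite [X in (_ * X)%E]probability_setT mule1.
  rewrite -EFinM -EFinD lee_fin mulr_natl mulr2n lerD2r.
  rewrite -ler_pdivlMl ?exprn_gt0 // -exprVn.
  exact: (sP j j (leqnn j) _ (s_mono j)).
- move=> n; have -> : \sum_(0 <= i < n) 2 * 2^-1 ^+ i = 4 - 4 * 2^-1 ^+ n :> R.
    elim: n => [|n IH]; first by rewrite big_geq // expr0 mulr1 subrr.
    by rewrite big_nat_recr //= IH exprS; field.
  by rewrite gerBl mulr_ge0.
have mZb : measurable_fun setT (fun x => x \in Z).
  by apply: (measurable_fun_bool true); rewrite setTI preimage_mem_true.
(* Replacing [u (s j)] by 0 off [Z] makes the sequence converge everywhere, so that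
   its limit is measurable. *)
pose v j x := if x \in Z then u (s j) x else 0.
have mv j : coord_measurable (v j).
  move=> i; rewrite (_ : (fun x => _) =
    (fun x => if x \in Z then u (s j) x 0 i else 0)).
    by apply: (measurable_fun_ifT mZb); [exact: ((Lu (s j)).1 i)|exact: measurable_cst].
  by apply/funext => x; rewrite /v; case: ifP; rewrite ?mxE.
have vcvg x : cvg (v j x @[j --> \oo]).
  have [xZ|/negbTE xZ] := boolP (x \in Z); last first.
    by rewrite /v xZ; exact: is_cvg_cst.
  rewrite /v xZ.
  apply: (nrm_summable_cvg ip_scalar) (Zcvg _ (set_mem xZ)) => j.
  rewrite -/(w j x) /b -(sqr_nrm ip_scalar).
  have t0 : 0 < 2 ^+ j :> R by rewrite exprn_gt0.
  rewrite exprVn; set t := 2 ^+ j in t0 *; set y := nrm _ _.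
  have y0 : 0 <= y by exact: nrm_ge0.
  rewrite -(@ler_pM2l _ t) // mulrDr mulfV ?gt_eqF //.
  have := sqr_ge0 (t * y - 1); have : 0 <= t * y by rewrite mulr_ge0 // ltW.
  rewrite !expr2; lra.
pose h x := lim (v j x @[j --> \oo]).
have mh : coord_measurable h.
  move=> i; apply: (@measurable_fun_cvg _ _ _ setT (fun j x => v j x 0 i)) => // [j|x _].
    exact: mv.
  exact: (cvg_comp _ _ (vcvg x) (@coord_continuous R 1 d 0 i (h x))).
have uv n j : esqnorm mu ip (fun x => u n x - v j x) =
              esqnorm mu ip (fun x => u n x - u (s j) x).
  have mun := (Lu n).1; have mus := (Lu (s j)).1.
  apply: ae_eq_eintegral.
  - by apply: measurable_ip => //; exact: coord_measurableB.
  - by apply: measurable_ip => //; exact: coord_measurableB.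
  - by move=> x; exact: ip_ge0.
  - by move=> x; exact: ip_ge0.
  exists (~` Z); split => //; first exact: measurableC.
  by move=> x /= nx Zx; apply: nx; rewrite /v mem_set.
have key e : 0 < e -> exists N, forall n, (N <= n)%N ->
    (esqnorm mu ip (fun x => (u n x - h x)%R) <= e%:E)%E.
  move=> e0; have [j je] : exists j, c j <= e.
    have : \forall j \near \oo, 2^-1 ^+ j < e.
      have := @cvg_expr R 2^-1; rewrite ger0_norm // invf_lt1 // ltr1n.
      move=> /(_ isT)/cvgrPdist_lt/(_ _ e0); apply: filterS => j.
      by rewrite sub0r normrN ger0_norm.
    move=> [j _ /(_ j (leqnn j)) je]; exists j.
    apply: le_trans (ltW je); rewrite /c ger_pMl ?exprn_gt0 //.
    by rewrite exprn_ile1 // invf_le1 // ler1n.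
  exists (s j) => n sn.
  apply: (@eintegral_cvg_le _ _ _ mu (fun k x => ip (u n x - v k x) (u n x - v k x))).
  - move=> k; have mu_v := coord_measurableB (Lu n).1 (mv k).
    exact: (measurable_ip ip_scalar mu_v mu_v).
  - by move=> k x; exact: ip_ge0.
  - move=> x; apply: (ip_cvg ip_scalar); apply: cvgB; first exact: cvg_cst.
    exact: vcvg.
  - exists j => // k /= jk.
    rewrite -/(esqnorm mu ip (fun x => u n x - v k x)) uv.
    rewrite (sqE ip_scalar); last exact: L2B.
    by rewrite lee_fin (le_trans _ je) // sP.
have Luh n e : (esqnorm mu ip (fun x => (u n x - h x)%R) <= e%:E)%E ->
    L2 (fun x => u n x - h x).
  move=> le; split; last by rewrite (le_lt_trans le) ?ltry.
  by apply: coord_measurableB => //; exact: (Lu n).1.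
have Lh : L2 h.
  have [N /(_ N (leqnn N)) /Luh LN] := key _ ltr01.
  rewrite (_ : h = fun x => u N x - (u N x - h x)); first exact: L2B.
  by apply/funext => x; rewrite subKr.
exists h => //.
apply/cvgrPdist_le => e e0; have [N NE] := key _ e0.
exists N => // n /= /NE le; rewrite sub0r normrN ger0_norm ?sq_ge0 //.
by apply: esq_le => //; exact: ltW.
Qed.

End Completeness.

Section Dot.
Context {dT : measure_display} {T : measurableType dT} {R : realType} {d : nat}.
Variables (mu : probability T R) (ip : 'rV[R]_d -> 'rV[R]_d -> R).
Hypothesis ip_scalar : scalar_product ip.

Local Notation sq := (sqnorm mu ip).
Local Notation L2 := (sq_integrable mu ip).
Implicit Types f g h : T -> 'rV[R]_d.

(** Convertible to [L2_dot], over an arbitrary measurable space. *)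
Definition L2inner f g : R := \int[mu]_x ip (f x) (g x).

Local Notation dot := L2inner.

Lemma integrable_ip f g : L2 f -> L2 g ->
  mu.-integrable setT (fun x => (ip (f x) (g x))%:E).
Proof.
move=> Lf Lg; have mfg := measurable_ip ip_scalar Lf.1 Lg.1.
apply/integrableP; split; first exact/measurable_EFinP.
have -> : (\int[mu]_x `|(ip (f x) (g x))%:E| =
           eintegral mu (fun x => `|ip (f x) (g x)|%R))%E.
  by [].
have mf := measurable_ip ip_scalar Lf.1 Lf.1.
have mg := measurable_ip ip_scalar Lg.1 Lg.1.
apply: (@le_lt_trans _ _ (eintegral mu (fun x => ip (f x) (f x) + ip (g x) (g x))%R)).
  apply: le_eintegral => //.
  - exact: measurableT_comp.
  - exact: measurable_funD.
  move=> x; have := ip_young ip_scalar (f x) (g x) ltr01.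
  by rewrite invr1 !mul1r; have := normr_ge0 (ip (f x) (g x)); lra.
rewrite eintegralD //; try by move=> x; exact: ip_ge0.
exact: lte_add_pinfty Lf.2 Lg.2.
Qed.

Lemma dotD f g k : L2 f -> L2 g -> L2 k ->
  dot (fun x => f x + g x) k = dot f k + dot g k.
Proof.
move=> Lf Lg Lk; rewrite /L2inner -RintegralD //; try exact: integrable_ip.
by apply: eq_Rintegral => x _; rewrite ipDl.
Qed.

Lemma dotC f g : dot f g = dot g f.
Proof. by apply: eq_Rintegral => x _; rewrite ipC. Qed.

Lemma dotZ a f k : L2 f -> L2 k -> dot (fun x => a *: f x) k = a * dot f k.
Proof.
move=> Lf Lk; rewrite /L2inner -RintegralZl //; last exact: integrable_ip.
by apply: eq_Rintegral => x _; rewrite ipZl.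
Qed.

Lemma dotN f k : L2 f -> L2 k -> dot (fun x => - f x) k = - dot f k.
Proof.
move=> Lf Lk; rewrite -mulN1r -dotZ //; congr dot.
by apply/funext => x; rewrite scaleN1r.
Qed.

Lemma dotB f g k : L2 f -> L2 g -> L2 k ->
  dot (fun x => f x - g x) k = dot f k - dot g k.
Proof. by move=> Lf Lg Lk; rewrite dotD ?dotN //; exact: L2N. Qed.

Lemma dot_sq f : dot f f = sq f.
Proof. by []. Qed.

Lemma sq_dotD f g : L2 f -> L2 g ->
  sq (fun x => f x + g x) = sq f + 2 * dot f g + sq g.
Proof.
move=> Lf Lg; rewrite -dot_sq.
rewrite dotD //; last exact: L2D.
by rewrite (dotC f) (dotC g) !dotD // (dotC g f) !dot_sq //; ring.
Qed.

Lemma dot_young t f g : 0 < t -> L2 f -> L2 g ->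
  2 * `|dot f g| <= t * sq f + t^-1 * sq g.
Proof.
move=> t0 Lf Lg.
have Ltf := L2Z ip_scalar t Lf.
have h := sq_ge0 mu ip_scalar (fun x => t *: f x + g x).
have h' := sq_ge0 mu ip_scalar (fun x => t *: f x + - g x).
rewrite sq_dotD // sqZ // dotZ // in h.
rewrite sq_dotD ?sqN // in h'; last exact: L2N.
rewrite sqZ // dotZ // in h'; last exact: L2N.
rewrite dotC dotN // dotC in h'.
rewrite -(@ler_pM2l _ t) // mulrDr (mulrA t t^-1) mulfV ?gt_eqF // mul1r.
by case: (ler0P (dot f g)) => _; move: h h'; lra.
Qed.

(** An almost everywhere vanishing function has zero square norm, and
    [dot_young] with a large weight then makes its inner products vanish. *)
Lemma ae_eq_dot f f' g : L2 f -> L2 f' -> L2 g -> {ae mu, forall x, f x = f' x} ->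
  dot f g = dot f' g.
Proof.
move=> Lf Lf' Lg ff'; apply/eqP; rewrite -subr_eq0 -dotB //.
have z : sq (fun x => f x - f' x) = 0.
  rewrite (@ae_eq_sq _ _ _ _ mu ip ip_scalar _ (fun=> 0)).
  - exact: sq0.
  - exact: (L2B ip_scalar Lf Lf').1.
  - by move=> i; exact: measurable_cst.
  - by apply: filterS ff' => x ->; rewrite subrr.
rewrite -normr_le0; apply/ler_addgt0Pr => e e0; rewrite add0r.
have t0 : 0 < (sq g + 1) / e by rewrite divr_gt0 // ltr_wpDl // sq_ge0.
have := dot_young t0 (L2B ip_scalar Lf Lf') Lg.
rewrite z mulr0 add0r invf_div => h.
have : e / (sq g + 1) * sq g <= e.
  rewrite mulrAC ler_pdivrMr ?ltr_wpDl ?sq_ge0 // ler_pM2l // lerDl //.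
have := normr_ge0 (dot (fun x => f x - f' x) g); lra.
Qed.

End Dot.

(** * Ergodic theorems for isometric cocycles *)

Lemma cvg_invn {R : realType} : (n%:R^-1 : R) @[n --> \oo] --> 0.
Proof. by rewrite -(cvg_shiftS (fun n => n%:R^-1 : R)); exact: cvg_harmonic. Qed.

Section Cocycle.
Context {dT : measure_display} {T : measurableType dT} {R : realType} {d : nat}.
Variables (mu : probability T R) (ip : 'rV[R]_d -> 'rV[R]_d -> R).
Variables (tau : T -> T) (A : T -> 'rV[R]_d -> 'rV[R]_d).
Hypothesis ip_scalar : scalar_product ip.
Hypothesis mtau : measurable_fun setT tau.
Hypothesis tau_mu : forall B, measurable B -> mu (tau @^-1` B) = mu B.
Hypothesis A_linear : forall x a u v, A x (a *: u + v) = a *: A x u + A x v.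
Hypothesis A_isometry : forall x u v, ip (A x u) (A x v) = ip u v.
Hypothesis A_measurable : forall v i, measurable_fun setT (fun x => A x v 0 i).

Local Notation sq := (sqnorm mu ip).
Local Notation esq := (esqnorm mu ip).
Local Notation L2 := (sq_integrable mu ip).
Local Notation dot := (L2inner mu ip).
Implicit Types f g h : T -> 'rV[R]_d.

(** The operator called W above. *)
Definition twist f : T -> 'rV[R]_d := fun x => A x (f (tau x)).

Definition mean f (N : nat) : T -> 'rV[R]_d :=
  fun x => N%:R^-1 *: \sum_(0 <= n < N) iter n twist f x.

Lemma fiber0 x : A x 0 = 0.
Proof.
have := A_linear x 1 0 0; rewrite !scale1r addr0 => h.
by apply: (addrI (A x 0)); rewrite -h addr0.
Qed.

Lemma fiberD x u v : A x (u + v) = A x u + A x v.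
Proof. by have := A_linear x 1 u v; rewrite !scale1r. Qed.

Lemma fiberZ x a u : A x (a *: u) = a *: A x u.
Proof. by have := A_linear x a u 0; rewrite !addr0 fiber0 addr0. Qed.

Lemma twistB f g x : twist (fun y => f y - g y) x = twist f x - twist g x.
Proof. by rewrite /twist fiberD -scaleN1r fiberZ scaleN1r. Qed.

Lemma fiber_sum x I (r : seq I) (P : pred I) (u : I -> 'rV[R]_d) :
  A x (\sum_(i <- r | P i) u i) = \sum_(i <- r | P i) A x (u i).
Proof. exact: (big_morph _ (fiberD x) (fiber0 x)). Qed.

Lemma iter_twistD n f g x :
  iter n twist (fun y => f y + g y) x = iter n twist f x + iter n twist g x.
Proof. by elim: n x => //= n IH x; rewrite /twist IH fiberD. Qed.

Lemma iter_twistZ n a f x :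
  iter n twist (fun y => a *: f y) x = a *: iter n twist f x.
Proof. by elim: n x => //= n IH x; rewrite /twist IH fiberZ. Qed.

(** The pointwise identity through which scalar ergodic theory governs W. *)
Lemma ip_iter_twist n f g x :
  ip (iter n twist f x) (iter n twist g x) =
  ip (f (iter n tau x)) (g (iter n tau x)).
Proof.
by elim: n x => //= n IH x; rewrite /twist A_isometry IH -iterS iterSr.
Qed.

Lemma nrm_iter_twist n f x : nrm ip (iter n twist f x) = nrm ip (f (iter n tau x)).
Proof. by rewrite /nrm ip_iter_twist. Qed.

Lemma coord_measurable_comp f : coord_measurable f -> coord_measurable (f \o tau).
Proof. by move=> mf i; exact: (measurableT_comp (mf i) mtau). Qed.

Lemma coord_measurable_twist f : coord_measurable f -> coord_measurable (twist f).
Proof.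
move=> mf i; rewrite (_ : (fun x => _) =
    (fun x => \sum_j (f (tau x) 0 j * A x (delta_mx 0 j) 0 i))).
  apply: measurable_sum => j; apply: measurable_funM => //.
  exact: coord_measurable_comp.
apply/funext => x; rewrite /twist {1}(row_sum_delta (f (tau x))) fiber_sum summxE.
by apply: eq_bigr => j _; rewrite fiberZ mxE.
Qed.

Lemma coord_measurable_iter n f :
  coord_measurable f -> coord_measurable (iter n twist f).
Proof. by move=> mf; elim: n => //= n IH; exact: coord_measurable_twist. Qed.

Lemma esq_iter_twist n f : coord_measurable f -> esq (iter n twist f) = esq f.
Proof.
move=> mf; rewrite -[RHS](@eintegral_iter _ _ _ mu tau mtau tau_mu n).
- by congr eintegral; apply/funext => x; rewrite ip_iter_twist.
- exact: measurable_ip.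
- by move=> x; exact: ip_ge0.
Qed.

Lemma L2_iter n f : L2 f -> L2 (iter n twist f).
Proof.
move=> [mf foo]; split; first exact: coord_measurable_iter.
by rewrite esq_iter_twist.
Qed.

Lemma L2_twist f : L2 f -> L2 (twist f).
Proof. exact: (@L2_iter 1). Qed.

Lemma sq_iter_twist n f : L2 f -> sq (iter n twist f) = sq f.
Proof. by move=> [mf _]; rewrite /sqnorm esq_iter_twist. Qed.

Lemma L2_mean N f : L2 f -> L2 (mean f N).
Proof.
move=> Lf; apply: L2Z => //; apply: L2_sum => // n; exact: L2_iter.
Qed.

Lemma meanD N f g x : mean (fun y => f y + g y) N x = mean f N x + mean g N x.
Proof.
rewrite /mean; under eq_bigr do rewrite iter_twistD.
by rewrite big_split scalerDr.
Qed.

Lemma meanZ N a f x : mean (fun y => a *: f y) N x = a *: mean f N x.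
Proof.
rewrite /mean; under eq_bigr do rewrite iter_twistZ.
by rewrite -scaler_sumr !scalerA mulrC.
Qed.

Lemma meanB N f g x : mean (fun y => f y - g y) N x = mean f N x - mean g N x.
Proof.
rewrite (_ : (fun y => _) = (fun y => f y + -1 *: g y)).
  by rewrite meanD meanZ scaleN1r.
by apply/funext => y; rewrite scaleN1r.
Qed.

Lemma ip_mean_le_orbit N f x : ip (mean f N x) (mean f N x) <=
  N%:R^-1 * \sum_(0 <= n < N) ip (f (iter n tau x)) (f (iter n tau x)).
Proof.
apply: le_trans (ip_mean_le ip_scalar N (fun n => iter n twist f x)) _.
by under eq_bigr do rewrite ip_iter_twist.
Qed.

Lemma nrm_mean_le_orbit N f x : nrm ip (mean f N x) <=
  N%:R^-1 * \sum_(0 <= n < N) nrm ip (f (iter n tau x)).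
Proof.
apply: le_trans (nrm_mean ip_scalar N (fun n => iter n twist f x)) _.
by under eq_bigr do rewrite nrm_iter_twist.
Qed.

Lemma sq_mean_le N f : L2 f -> sq (mean f N) <= sq f.
Proof.
move=> Lf; have Lm := L2_mean N Lf; rewrite -lee_fin -!sqE //.
have mf n : measurable_fun setT (fun x => ip (f (iter n tau x)) (f (iter n tau x))).
  apply: (measurableT_comp (measurable_ip ip_scalar Lf.1 Lf.1)).
  exact: measurable_iter.
have f0 n x : 0 <= ip (f (iter n tau x)) (f (iter n tau x)) by exact: ip_ge0.
have ms : measurable_fun setT
    (fun x => \sum_(0 <= n < N) ip (f (iter n tau x)) (f (iter n tau x))).
  exact: measurable_sum.
apply: (@le_trans _ _ (eintegral mu (fun x => N%:R^-1 *
    \sum_(0 <= n < N) ip (f (iter n tau x)) (f (iter n tau x))))).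
  apply: le_eintegral.
  - exact: (measurable_ip ip_scalar Lm.1 Lm.1).
  - by apply: measurable_funM => //; exact: measurable_cst.
  - by move=> x; exact: ip_ge0.
  - by move=> x; exact: ip_mean_le_orbit.
rewrite eintegralZ //; last by move=> x; rewrite sumr_ge0.
rewrite (@eintegral_sum _ _ _ mu N (fun n x => ip (f (iter n tau x)) (f (iter n tau x)))) //.
have E n : eintegral mu (fun x => ip (f (iter n tau x)) (f (iter n tau x))) = (sq f)%:E.
  rewrite -(sqE ip_scalar Lf) -(esq_iter_twist n Lf.1).
  by congr eintegral; apply/funext => x; rewrite ip_iter_twist.
under eq_bigr do rewrite E.
rewrite sumEFin sumr_const_nat subn0 (sqE ip_scalar Lf) -EFinM lee_fin.
rewrite -[sq f *+ N]mulr_natl mulrA.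
have [->|N0] := eqVneq (N%:R : R) 0; first by rewrite mulr0 mul0r sq_ge0.
by rewrite mulVf // mul1r.
Qed.

Definition coboundary u := exists2 g, L2 g & u = (fun x => g x - twist g x).

Lemma coboundary0 : coboundary (fun=> 0).
Proof.
exists (fun=> 0); first exact: L2_0.
by apply/funext => x; rewrite /twist fiber0 subr0.
Qed.

Lemma coboundaryD u v : coboundary u -> coboundary v ->
  coboundary (fun x => u x + v x).
Proof.
move=> [f Lf ->] [g Lg ->]; exists (fun x => f x + g x); first exact: L2D.
by apply/funext => x; rewrite /twist fiberD opprD addrACA.
Qed.

Lemma coboundaryZ a u : coboundary u -> coboundary (fun x => a *: u x).
Proof.
move=> [f Lf ->]; exists (fun x => a *: f x); first exact: L2Z.
by apply/funext => x; rewrite /twist fiberZ scalerBr.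
Qed.

Lemma coboundary_iter n f : L2 f -> coboundary (fun x => f x - iter n twist f x).
Proof.
move=> Lf; elim: n => [|n IH].
  rewrite (_ : (fun x => _) = (fun=> 0)); first exact: coboundary0.
  by apply/funext => x; rewrite subrr.
rewrite (_ : (fun x => _) = (fun x => (f x - iter n twist f x) +
    (iter n twist f x - twist (iter n twist f) x))).
  by apply: coboundaryD => //; exists (iter n twist f) => //; exact: L2_iter.
by apply/funext => x; rewrite subrKA.
Qed.

(** f - M_N f is the average of the f - W^n f, each a telescoping sum of
    coboundaries. *)
Lemma coboundary_mean N f : (0 < N)%N -> L2 f ->
  coboundary (fun x => f x - mean f N x).
Proof.
move=> N0 Lf.
rewrite (_ : (fun x => _) = (fun x => N%:R^-1 *:
    \sum_(0 <= n < N) (f x - iter n twist f x))).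
  apply: coboundaryZ; elim: {N0} N => [|N IH].
    rewrite (_ : (fun x => _) = (fun=> 0)); first exact: coboundary0.
    by apply/funext => x; rewrite big_geq.
  rewrite (_ : (fun x => _) = (fun x => \sum_(0 <= n < N) (f x - iter n twist f x)
      + (f x - iter N twist f x))).
    by apply: coboundaryD => //; exact: coboundary_iter.
  by apply/funext => x; rewrite big_nat_recr.
apply/funext => x; rewrite sumrB scalerBr sumr_const_nat subn0 -[f x *+ N]scaler_nat.
by rewrite scalerA mulVf ?scale1r // pnatr_eq0 -lt0n.
Qed.

Lemma mean_coboundaryE N g x :
  mean (fun y => g y - twist g y) N x = N%:R^-1 *: (g x - iter N twist g x).
Proof.
rewrite /mean; congr (N%:R^-1 *: _).
have E n : iter n twist (fun y => g y - twist g y) x =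
    iter n twist g x - iter n.+1 twist g x.
  rewrite (_ : (fun y => _) = (fun y => g y + -1 *: twist g y)).
    by rewrite iter_twistD iter_twistZ scaleN1r iterSr.
  by apply/funext => y; rewrite scaleN1r.
under eq_bigr do rewrite E.
elim: N => [|N IH]; first by rewrite big_geq // subrr.
by rewrite big_nat_recr //= IH subrKA.
Qed.

Lemma sq_mean_coboundary u : coboundary u -> sq (mean u N) @[N --> \oo] --> 0.
Proof.
move=> [g Lg ->].
have bound N : sq (mean (fun x => g x - twist g x) N) <= N%:R^-1 * (4 * sq g).
  rewrite (_ : mean _ N = (fun x => N%:R^-1 *: (g x - iter N twist g x))); last first.
    by apply/funext => x; exact: mean_coboundaryE.
  have LN := L2_iter N Lg.
  rewrite sqZ //; last exact: L2B.
  have le4 : sq (fun x => g x - iter N twist g x) <= 4 * sq g.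
    apply: le_trans (sqB_le2 ip_scalar Lg LN) _; rewrite sq_iter_twist //; lra.
  have le1 : N%:R^-1 ^+ 2 <= N%:R^-1 :> R.
    case: N {LN le4} => [|N]; first by rewrite invr0 expr0n.
    by rewrite expr2 ger_pMl ?invr_gt0 // invf_le1 // ler1n.
  apply: le_trans (_ : N%:R^-1 * sq (fun x => g x - iter N twist g x) <= _).
    by apply: ler_wpM2r => //; exact: sq_ge0.
  by apply: ler_wpM2l.
apply: (@squeeze_cvgr _ _ _ _ (fun=> 0) (fun N => N%:R^-1 * (4 * sq g))).
- by apply: nearW => N; rewrite sq_ge0 //= bound.
- exact: cvg_cst.
- rewrite -[X in _ --> X](mul0r (4 * sq g)); apply: cvgMr_tmp.
  exact: cvg_invn.
Qed.

(** F. Riesz's proof of the mean ergodic theorem: the averages form a minimizing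
    sequence for the norm on
    the convex set of the functions that differ from [f] by a coboundary, and
    minimizing sequences in a convex set are Cauchy by the parallelogram law. *)
Lemma mean_cauchy f : L2 f -> forall e, 0 < e -> exists N, forall n m,
  (N <= n)%N -> (N <= m)%N -> sq (fun x => mean f n x - mean f m x) <= e.
Proof.
move=> Lf e e0.
pose K : set R := [set r | exists k, [/\ L2 k, coboundary (fun x => f x - k x) & r = sq k]].
have lbK : has_lbound K by exists 0 => _ [k [_ _ ->]]; exact: sq_ge0.
have infK : has_inf K.
  split=> //; exists (sq f), f; split => //.
  rewrite (_ : (fun x => _) = (fun=> 0)); first exact: coboundary0.
  by apply/funext => x; rewrite subrr.
set al := inf K.
have al0 : 0 <= al.
  by apply: lb_le_inf; [case: infK|move=> _ [k [_ _ ->]]; exact: sq_ge0].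
have near_inf r : 0 < r -> exists N, forall n, (N <= n)%N -> sq (mean f n) <= al + 3 * r.
  move=> r0; have [_ [k [Lk cobk ->]] kal] := inf_adherent r0 infK.
  have s0 : 0 < al + r by rewrite ltr_wpDl.
  (* The weight for which (1 + t) (al + r) = al + 2 r. *)
  pose t := r / (al + r); have t0 : 0 < t by rewrite divr_gt0.
  have t1 : 0 < 1 + t^-1 by rewrite addr_gt0 // invr_gt0.
  have rt0 : 0 < r / (1 + t^-1) by rewrite divr_gt0.
  have /cvgrPdist_le/(_ _ rt0)[N _ NP] := sq_mean_coboundary cobk.
  exists N => n /NP /=; rewrite sub0r normrN ger0_norm ?sq_ge0 // => nr.
  have Ld : L2 (mean (fun x => f x - k x) n) by apply: L2_mean; exact: L2B.
  have [_] := sqD_le ip_scalar t0 (L2_mean n Lk) Ld.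
  rewrite (_ : (fun x => _ + _) = mean f n); last first.
    by apply/funext => x; rewrite -meanD; congr mean; apply/funext => y; rewrite subrKC.
  move=> /le_trans; apply.
  have h1 : (1 + t) * sq (mean k n) <= (1 + t) * (al + r).
    rewrite ler_pM2l ?addr_gt0 // (le_trans (sq_mean_le n Lk)) //; exact: ltW.
  have h2 : (1 + t) * (al + r) = al + 2 * r by rewrite /t; field; rewrite gt_eqF.
  have h3 : (1 + t^-1) * sq (mean (fun x => f x - k x) n) <= r.
    by rewrite mulrC -ler_pdivlMr.
  lra.
have e12 : 0 < e / 12 by rewrite divr_gt0.
have [N NP] := near_inf _ e12.
(* [mean f 0] is 0, which is not an average of [f]. *)
exists (maxn N 1) => n m; rewrite !geq_max => /andP[Nn n0] /andP[Nm m0].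
have := NP _ Nn; have := NP _ Nm.
have Ln := L2_mean n Lf; have Lm := L2_mean m Lf.
have := sq_parallelogram ip_scalar Ln Lm.
suff : al <= sq (fun x => 2^-1 *: (mean f n x + mean f m x)) by lra.
apply: ge_inf => //; eexists; split; last reflexivity.
  by apply: L2Z => //; exact: L2D.
rewrite (_ : (fun x => _) = (fun x => 2^-1 *:
    ((f x - mean f n x) + (f x - mean f m x)))).
  by apply: coboundaryZ; apply: coboundaryD; exact: coboundary_mean.
apply/funext => x; rewrite addrACA -opprD scalerBr -[f x + f x]mulr2n.
by rewrite -[f x *+ 2]scaler_nat scalerA mulVf ?scale1r // pnatr_eq0.
Qed.

Lemma mean_twist N f x : mean (twist f) N x = twist (mean f N) x.
Proof.
rewrite /twist /mean fiberZ fiber_sum; congr (N%:R^-1 *: _); apply: eq_bigr => n _.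
by rewrite -/(twist (iter n twist f) x) -iterS iterSr.
Qed.

(** Membership in ker (1 - W), up to integrability. *)
Definition invariant h := {ae mu, forall x, h x - twist h x = 0}.

(** Polarization: W preserves [sq], hence [dot], so that for W k = k one has
    dot (W g) k = dot (W g) (W k) = dot g k. *)
Lemma dot_coboundary u k : coboundary u -> L2 k -> invariant k -> dot u k = 0.
Proof.
move=> [g Lg ->] Lk kW; have LWg := L2_twist Lg; have LWk := L2_twist Lk.
have kWk : {ae mu, forall x, k x = twist k x}.
  by apply: filterS kW => x /eqP; rewrite subr_eq0 => /eqP.
have EW : dot (twist g) k = dot (twist g) (twist k).
  rewrite (dotC mu ip_scalar) (ae_eq_dot ip_scalar Lk LWk LWg kWk).
  exact: dotC.
have E : sq (fun x => g x + k x) = sq (fun x => twist g x + twist k x).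
  rewrite -(sq_iter_twist 1 (L2D ip_scalar Lg Lk)); congr sq.
  by apply/funext => x; rewrite /= /twist fiberD.
have Eg : sq (twist g) = sq g := sq_iter_twist 1 Lg.
have Ek : sq (twist k) = sq k := sq_iter_twist 1 Lk.
rewrite (dotB ip_scalar Lg LWg Lk) EW; move: E.
by rewrite (sq_dotD ip_scalar Lg Lk) (sq_dotD ip_scalar LWg LWk) Eg Ek; lra.
Qed.

(** The limit is invariant because M_N f - W (M_N f) is the average of a
    coboundary.  It has the same inner products as [f] with invariant functions
    because f - M_N f is a coboundary. *)
Lemma mean_ergodic f : L2 f -> exists h, [/\ L2 h, invariant h,
  forall k, L2 k -> invariant k -> dot (fun x => f x - h x) k = 0 &
  sq (fun x => mean f N x - h x) @[N --> \oo] --> 0].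
Proof.
move=> Lf; have Lm N := L2_mean N Lf.
have [h Lh hm] := L2_complete ip_scalar Lm (mean_cauchy Lf).
have LWh := L2_twist Lh.
exists h; split => //.
  apply: (sq_eq0_ae ip_scalar); first exact: L2B.
  have bound N : sq (fun x => h x - twist h x) <=
      6 * sq (fun x => mean f N x - h x) + 4 * sq (mean (fun x => f x - twist f x) N).
    have := sqB_triangle2 ip_scalar Lh (Lm N) LWh.
    have := sqB_triangle2 ip_scalar (Lm N) (L2_twist (Lm N)) LWh.
    rewrite (sqBC mu ip_scalar h (mean f N)).
    have -> : sq (fun x => twist (mean f N) x - twist h x) = sq (fun x => mean f N x - h x).
      rewrite -(sq_iter_twist 1 (L2B ip_scalar (Lm N) Lh)); congr sq.
      by apply/funext => x; rewrite /= twistB.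
    have -> : sq (fun x => mean f N x - twist (mean f N) x) =
        sq (mean (fun x => f x - twist f x) N).
      by congr sq; apply/funext => x; rewrite meanB mean_twist.
    lra.
  have lim0 : 6 * sq (fun x => mean f N x - h x) +
      4 * sq (mean (fun x => f x - twist f x) N) @[N --> \oo] --> (0 : R).
    have cob : coboundary (fun x => f x - twist f x) by exists f.
    have := cvgD (cvgM (cvg_cst (6 : R)) hm)
                 (cvgM (cvg_cst (4 : R)) (sq_mean_coboundary cob)).
    rewrite !mulr0 addr0; exact.
  apply/eqP; rewrite eq_le sq_ge0 // andbT -(cvg_lim _ lim0) //.
  by apply: limr_ge; [exact: cvgP lim0|exact: nearW].
move=> k Lk kW; have Lfh := L2B ip_scalar Lf Lh.
apply/eqP; rewrite -normr_le0; apply/ler_addgt0Pr => e e0; rewrite add0r.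
have k0 : 0 < sq k + 1 by rewrite ltr_wpDl // sq_ge0.
pose t := (sq k + 1) / e; have t0 : 0 < t by rewrite divr_gt0.
have et0 : 0 < e / t by rewrite divr_gt0.
have /cvgrPdist_le/(_ _ et0)[N _ NP] := hm.
have := NP _ (leqnSn N); rewrite /= sub0r normrN ger0_norm ?sq_ge0 // => le.
have -> : dot (fun x => f x - h x) k = dot (fun x => mean f N.+1 x - h x) k.
  have cob := dot_coboundary (coboundary_mean (ltn0Sn N) Lf) Lk kW.
  by move: cob; rewrite !dotB //; lra.
have := dot_young ip_scalar t0 (L2B ip_scalar (Lm N.+1) Lh) Lk.
have : t * sq (fun x => mean f N.+1 x - h x) <= e by rewrite mulrC -ler_pdivlMr.
have : t^-1 * sq k <= e.
  by rewrite /t invf_div mulrAC ler_pdivrMr // ler_pM2l // lerDl.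
lra.
Qed.

(** The orthogonal projection of [f] onto the invariant functions is unique almost
    everywhere: the difference of two candidates is invariant and orthogonal to
    itself. *)
Lemma mean_cvg_proj f p : L2 f -> L2 p -> invariant p ->
  (forall k, L2 k -> invariant k -> dot (fun x => f x - p x) k = 0) ->
  sq (fun x => mean f N x - p x) @[N --> \oo] --> 0.
Proof.
move=> Lf Lp pW fp; have [h [Lh hW fh hm]] := mean_ergodic Lf.
have Lph := L2B ip_scalar Lp Lh.
have phW : invariant (fun x => p x - h x).
  apply: filterS2 pW hW => x px hx.
  by rewrite twistB -(subr0_eq px) -(subr0_eq hx) subrr.
have ph : {ae mu, forall x, p x - h x = 0}.
  apply: (sq_eq0_ae ip_scalar Lph).
  have := fp _ Lph phW; have := fh _ Lph phW.
  by rewrite -dot_sq !dotB //; lra.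
rewrite (_ : (fun N => _) = (fun N => sq (fun x => mean f N x - h x))) //.
apply/funext => N; apply: (ae_eq_sq ip_scalar).
- exact: (L2B ip_scalar (L2_mean N Lf) Lp).1.
- exact: (L2B ip_scalar (L2_mean N Lf) Lh).1.
- by apply: filterS ph => x /eqP; rewrite subr_eq0 => /eqP ->.
Qed.

(** The only difficulty is that |g (tau^N x)|^2 / N^2 tends to 0.  By the
    maximal inequality the averages of |g|^2 along almost every orbit are
    bounded, so |g (tau^N x)|^2 grows at most linearly in [N]. *)
Lemma mean_coboundary_ae u : coboundary u ->
  {ae mu, forall x, mean u N x @[N --> \oo] --> (0 : 'rV[R]_d)}.
Proof.
move=> [g Lg ->]; have mg := measurable_ip ip_scalar Lg.1 Lg.1.
pose v m x := m.+1%:R^-1 * ip (g x) (g x).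
have mv m : measurable_fun setT (v m).
  by apply: measurable_funM => //; exact: measurable_cst.
have v0 m x : 0 <= v m x by rewrite mulr_ge0 // ip_ge0.
have cv : eintegral mu (v m) @[m --> \oo] --> 0%E.
  have -> : (fun m => eintegral mu (v m)) = (fun m => (m.+1%:R^-1 * sq g)%:E).
    apply/funext => m; rewrite eintegralZ // => [|x]; last exact: ip_ge0.
    by rewrite -/(esq g) (sqE ip_scalar Lg) EFinM.
  apply: cvg_EFin; first exact: nearW.
  by have := cvgM (@cvg_harmonic R) (cvg_cst (sq g)); rewrite mul0r; exact.
have := maximal_ae mtau tau_mu mv v0 cv; apply: filterS => x /(_ 0%N)[m mx].
apply: (ip_cvg0 ip_scalar).
pose C := 2 * ip (g x) (g x) + 4 * m.+1%:R.
have C0 : 0 <= C by rewrite addr_ge0 ?mulr_ge0 // ip_ge0.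
apply: (@squeeze_cvgr _ _ _ _ (fun=> 0) (fun N => N%:R^-1 * C)).
- apply: nearW => N; rewrite subr0 ip_ge0 //= mean_coboundaryE ipZZ //.
  case: N => [|N]; first by rewrite invr0 expr0n !mul0r.
  rewrite expr2 -mulrA ler_wpM2l // ler_pdivrMl //.
  apply: (@le_trans _ _ (2 * ip (g x) (g x) +
      2 * ip (g (iter N.+1 tau x)) (g (iter N.+1 tau x)))).
    have := ipD_le2 ip_scalar (g x) (- iter N.+1 twist g x).
    by rewrite ipNN // ip_iter_twist.
  have h : ip (g (iter N.+1 tau x)) (g (iter N.+1 tau x)) <= N.+2%:R * m.+1%:R.
    rewrite -ler_pdivrMr // mulrC.
    have := mx N.+2; rewrite invr1 mulr1 big_nat_recr //=; apply: le_trans.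
    by rewrite lerDr sumr_ge0.
  have N1 : 1 <= N.+1%:R :> R by rewrite ler1n.
  rewrite /C mulrDr lerD //; first by rewrite ler_peMl // mulr_ge0 // ip_ge0.
  rewrite -natr1 in h; apply: le_trans (_ : 2 * ((N.+1%:R + 1) * m.+1%:R) <= _).
    by rewrite ler_pM2l.
  have : m.+1%:R <= N.+1%:R * m.+1%:R :> R by rewrite ler_peMl.
  lra.
- exact: cvg_cst.
- by have := cvgM (@cvg_invn R) (cvg_cst C); rewrite mul0r; exact.
Qed.

Lemma ae_orbit (P : T -> Prop) : {ae mu, forall x, P x} ->
  {ae mu, forall x, forall n, P (iter n tau x)}.
Proof.
move=> [B [mB B0 PB]]; apply: ae_foralln => n.
exists (iter n tau @^-1` B); split.
- by rewrite -[X in measurable X]setTI; exact: (measurable_iter mtau n).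
- elim: n => //= n IH; rewrite -IH.
  rewrite -[RHS]tau_mu; last first.
    by rewrite -[X in measurable X]setTI; exact: (measurable_iter mtau n).
  by congr (mu _); apply/seteqP; split => x /=; rewrite -iterS iterSr.
- by move=> x /= nP; exact: PB.
Qed.

Lemma mean_invariant h : invariant h ->
  {ae mu, forall x, forall N, (0 < N)%N -> mean h N x = h x}.
Proof.
move=> /ae_orbit; apply: filterS => x hx N N0.
have E n : forall y, (forall j, h (iter j tau y) - twist h (iter j tau y) = 0) ->
    iter n twist h y = h y.
  elim: n => // n IH y hy; rewrite /= /twist IH.
    by have /eqP := hy 0%N; rewrite subr_eq0 => /eqP.
  by move=> j; rewrite -iterSr; exact: hy.
rewrite /mean; under eq_bigr do rewrite E //.
rewrite sumr_const_nat subn0 -[h x *+ N]scaler_nat scalerA mulVf ?scale1r //.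
by rewrite pnatr_eq0 -lt0n.
Qed.

(** Banach's principle: f - h is, up to a function [r M] of small norm, a
    coboundary, and the averages of [r M] are controlled by the maximal
    inequality applied to |r M|^2. *)
Lemma mean_pointwise f h : L2 f -> L2 h -> invariant h ->
  sq (fun x => mean f N x - h x) @[N --> \oo] --> 0 ->
  {ae mu, forall x, mean f N x @[N --> \oo] --> h x}.
Proof.
move=> Lf Lh hW fh.
pose r M x := mean f M.+1 x - h x.
have Lr M : L2 (r M) by apply: L2B => //; exact: L2_mean.
pose v M x := ip (r M x) (r M x).
have mv M : measurable_fun setT (v M).
  exact: (measurable_ip ip_scalar (Lr M).1 (Lr M).1).
have v0 M x : 0 <= v M x by exact: ip_ge0.
have cv : eintegral mu (v M) @[M --> \oo] --> 0%E.
  have -> : (fun M => eintegral mu (v M)) = (fun M => (sq (r M))%:E).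
    by apply/funext => M; rewrite -(sqE ip_scalar (Lr M)).
  apply: cvg_EFin; first exact: nearW.
  by move: fh; rewrite -(cvg_shiftS (fun N => sq (fun x => mean f N x - h x))).
have aeM := maximal_ae mtau tau_mu mv v0 cv.
have aeC : {ae mu, forall x, forall M,
    mean (fun y => f y - mean f M.+1 y) N x @[N --> \oo] --> (0 : 'rV[R]_d)}.
  by apply: ae_foralln => M; apply: mean_coboundary_ae; exact: coboundary_mean.
have aeI := mean_invariant hW.
apply: filterS3 aeM aeC aeI => x xM xC xI.
apply: (ip_cvg0 ip_scalar); apply/cvgrPdist_le => e e0.
have [k ke] : exists k : nat, k.+1%:R^-1 <= e / 4.
  have e4 : 0 < e / 4 by rewrite divr_gt0.
  have /cvgrPdist_le/(_ _ e4)[k _ kP] := @cvg_harmonic R.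
  exists k; have := kP k (leqnn k); rewrite /= sub0r normrN ger0_norm //.
have [M {}xM] := xM k.
have e4 : 0 < e / 4 by rewrite divr_gt0.
have /(ip_cvg ip_scalar)/cvgrPdist_le/(_ _ e4) := xC M.
rewrite ip0l //; move=> [N0 _ NP].
exists N0.+1 => // N /= NN; have {}NP := NP N (ltnW NN).
have Npos : (0 < N)%N by exact: leq_trans NN.
rewrite sub0r normrN ger0_norm ?ip_ge0 //.
move: NP; rewrite /= sub0r normrN ger0_norm ?ip_ge0 // => NP.
have -> : mean f N x - h x =
    mean (fun y => f y - mean f M.+1 y) N x + mean (r M) N x.
  rewrite -meanD -(xI _ Npos) -meanB; congr mean.
  by apply/funext => y; rewrite /r addrA subrK.
apply: le_trans (ipD_le2 ip_scalar _ _) _.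
have : ip (mean (r M) N x) (mean (r M) N x) <= e / 4.
  apply: le_trans (ip_mean_le_orbit N (r M) x) _.
  apply: le_trans ke; rewrite ler_pdivrMl ?ltr0n //; exact: xM.
lra.
Qed.

Lemma measurable_nrm f : coord_measurable f ->
  measurable_fun setT (fun x => nrm ip (f x)).
Proof.
move=> mf; apply: (measurableT_comp _ (measurable_ip ip_scalar mf mf)).
apply: continuous_measurable_fun; exact: sqrt_continuous.
Qed.

(** The truncations [fk k] are bounded, hence square-integrable, and converge to
    [f] in L^1 by dominated convergence; the maximal inequality applied to
    |f - fk k| carries the convergence of the averages over to [f]. *)
Lemma mean_pointwise_L1 f : coord_measurable f ->
  (eintegral mu (fun x => nrm ip (f x)) < +oo)%E ->
  {ae mu, forall x, cvg (mean f N x @[N --> \oo])}.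
Proof.
move=> mf foo; have mn := measurable_nrm mf.
have n0 x : 0 <= nrm ip (f x) by exact: nrm_ge0.
pose fk (k : nat) x := if nrm ip (f x) <= k%:R then f x else 0.
have mfk k : coord_measurable (fk k).
  move=> i; rewrite (_ : (fun x => _) =
      (fun x => if nrm ip (f x) <= k%:R then f x 0 i else 0)).
    apply: measurable_fun_ifT; [|exact: mf|exact: measurable_cst].
    by apply: measurable_fun_ler => //; exact: measurable_cst.
  by apply/funext => x; rewrite /fk; case: ifP; rewrite ?mxE.
have Lfk k : L2 (fk k).
  split => //; apply: (@le_lt_trans _ _ (eintegral mu (fun=> k%:R ^+ 2))).
    apply: le_eintegral; [exact: measurable_ip|exact: measurable_cst| |].
      by move=> x; exact: ip_ge0.
    move=> x; rewrite -(sqr_nrm ip_scalar) ler_pXn2r ?nnegrE ?nrm_ge0 //.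
    by rewrite /fk; case: ifP => // _; rewrite nrm0.
  rewrite /eintegral (integral_cst mu measurableT (k%:R ^+ 2)%:E).
  by rewrite [X in (_ * X)%E]probability_setT mule1 ltry.
pose v k x := nrm ip (f x - fk k x).
have mv k : measurable_fun setT (v k).
  by apply: measurable_nrm; exact: coord_measurableB.
have v0 k x : 0 <= v k x by exact: nrm_ge0.
have vf k x : v k x <= nrm ip (f x).
  by rewrite /v /fk; case: ifP => _; rewrite ?subrr ?nrm0 ?subr0.
have cv : eintegral mu (v k) @[k --> \oo] --> 0%E.
  have -> : 0%E = (\int[mu]_x (cst 0 x : \bar R))%E by rewrite integral0.
  apply: (@dominated_cvg _ _ _ mu setT measurableT (fun k x => (v k x)%:E) (cst 0%E)
    (fun x => (nrm ip (f x))%:E)).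
  - by move=> k; exact/measurable_EFinP.
  - move=> x _; apply: cvg_near_cst.
    have [k _ kP] : \forall k \near \oo, nrm ip (f x) <= k%:R.
      exact: nbhs_infty_ger.
    exists k => // j /= kj; rewrite /v /fk kP // subrr nrm0 //.
  - by [].
  - apply/integrableP; split; first exact/measurable_EFinP.
    by under eq_integral do rewrite gee0_abs ?lee_fin //.
  - by move=> k x _; rewrite gee0_abs ?lee_fin.
have aeM := maximal_ae mtau tau_mu mv v0 cv.
have aeC : {ae mu, forall x, forall k, cvg (mean (fk k) N x @[N --> \oo])}.
  apply: ae_foralln => k; have [h [Lh hW _ hm]] := mean_ergodic (Lfk k).
  by have := mean_pointwise (Lfk k) Lh hW hm; apply: filterS => x /cvgP.
apply: filterS2 aeM aeC => x xM xC.
apply: (nrm_cauchy ip_scalar) => e e0.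
have e4 : 0 < e / 4 by rewrite divr_gt0.
have [k ke] : exists k : nat, k.+1%:R^-1 <= e / 4.
  have /cvgrPdist_le/(_ _ e4)[k _ kP] := @cvg_harmonic R.
  exists k; have := kP k (leqnn k); rewrite /= sub0r normrN ger0_norm //.
have [M {}xM] := xM k.
have small N : (0 < N)%N -> nrm ip (mean (fun y => f y - fk M y) N x) <= e / 4.
  move=> N0; apply: le_trans (nrm_mean_le_orbit N _ x) _.
  apply: le_trans ke; rewrite ler_pdivrMl ?ltr0n //; exact: xM.
have /cvg_ex[l xl] := xC M.
have : ip (mean (fk M) N x - l) (mean (fk M) N x - l) @[N --> \oo] --> 0.
  rewrite -(ip0l ip_scalar 0); apply: ip_cvg => //; rewrite -(subrr l).
  by apply: cvgB => //; exact: cvg_cst.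
have e42 : 0 < (e / 4) ^+ 2 by rewrite exprn_gt0.
move=> /cvgrPdist_le/(_ _ e42)[N1 _ N1P].
have lim N : (N1 <= N)%N -> nrm ip (mean (fk M) N x - l) <= e / 4.
  move=> /N1P /=; rewrite sub0r normrN ger0_norm ?ip_ge0 // -(sqr_nrm ip_scalar).
  by rewrite ler_pXn2r ?nnegrE ?nrm_ge0 // ltW.
have near_l N : (maxn N1 1 <= N)%N -> nrm ip (mean f N x - l) <= e / 2.
  rewrite geq_max => /andP[h1 h2].
  have -> : mean f N x - l =
      mean (fun y => f y - fk M y) N x + (mean (fk M) N x - l).
    by rewrite meanB addrA subrK.
  apply: le_trans (nrmD ip_scalar _ _) _; have := small _ h2; have := lim _ h1; lra.
exists (maxn N1 1) => n m hn hm.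
rewrite -(subrKA l) -(opprB _ l); apply: le_trans (nrmD ip_scalar _ _) _.
by rewrite nrmN //; have := near_l _ hn; have := near_l _ hm; lra.
Qed.

End Cocycle.

(** * The adjoint representation in charts *)

Section Differentiability.
Context {R : realType}.

(** [diff] is defined by choice among the linear maps that fit the function, so
    the locality of differentiability needs an argument. *)
Lemma near_eq_differentiable (V W : normedModType R) (f g : V -> W) (a : V) :
  (\near a, f a = g a) -> differentiable f a -> differentiable g a.
Proof.
move=> fg df; have fga : f a = g a by exact: nbhs_singleton fg.
have [dfc dfE] := (@diff_locallyP _ _ _ a f).1 df.
have dgE : g \o shift a = cst (g a) + 'd f a +o_ 0 id.
  apply/eqaddoP => _/posnumP[e].
  have /eqaddoP /(_ e%:num) /(_ [gt0 of e%:num]) := dfE.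
  apply: filter_app.
  have : \forall h \near (0 : V), f (h + a) = g (h + a).
    by move: fg; rewrite (near_shift 0 a) /= subr0.
  apply: filterS => h fgh.
  by rewrite /= !fctE /= fgh fga.
apply/diff_locallyP; rewrite (diff_unique dfc dgE); split => //.
Qed.

Lemma differentiable_pairl (U V W : normedModType R) (f : U * V -> W) a b :
  differentiable f (a, b) -> differentiable (fun v => f (a, v)) b.
Proof.
by move=> df; apply: (@differentiable_comp _ _ _ _ (fun v => (a, v)) f).
Qed.

Lemma differentiable_pairr (U V W : normedModType R) (f : U * V -> W) a b :
  differentiable f (a, b) -> differentiable (fun u => f (u, b)) a.
Proof.
by move=> df; apply: (@differentiable_comp _ _ _ _ (fun u => (u, b)) f).
Qed.

End Differentiability.

Section BorelMeasurability.
Context {R : realType}.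

Lemma within_continuous_measurable_fun (T : ptopologicalType) (D : set T)
    (f : T -> R) : open D -> {within D, continuous f} ->
  measurable_fun (D : set (borel T)) (f : borel T -> R).
Proof.
move=> oD /continuousP cf; apply: (measurability _ (RGenOpens.measurableE R)).
move=> _ [_ [a [b ->] <-]]; apply: sub_sigma_algebra.
have /open_subspaceP[V oV VD] : open (f @^-1` `]a, b[ : set (subspace D)).
  exact/cf/interval_open.
by rewrite setIC -VD; exact: openI.
Qed.

Lemma continuous_borel_measurable (T U : ptopologicalType) (f : T -> U) :
  continuous f -> measurable_fun [set: borel T] (f : borel T -> borel U).
Proof.
move=> /continuousP cf.
apply: (@measurability _ _ (borel T) (borel U) setT f (@open U)) => //.
by move=> _ [A oA <-]; rewrite setTI; apply: sub_sigma_algebra; exact: cf.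
Qed.

End BorelMeasurability.

Section AdjointMeasurable.
Context {R : realType} {d : nat} {G : groupTopologicalType}.
Variables (AG : set (chart 'rV[R]_d G)) (c : chart 'rV[R]_d G).
Hypotheses (G_lie : lie_group AG) (AG_c : AG c) (c_1 : dom c 1%g).

Let conj g (x : G) : G := (g * x * g^-1)%g.

Lemma mulg_continuous2 : continuous (fun p : G * G => (p.1 * p.2)%g).
Proof. by have [_ /(_ 0%N)[]] := G_lie. Qed.

Lemma invg_continuous : continuous (fun g : G => g^-1%g).
Proof. by have [_ _ /(_ 0%N)[]] := G_lie. Qed.

Lemma mulg_continuous (f g : G -> G) : continuous f -> continuous g ->
  continuous (fun x => (f x * g x)%g).
Proof.
move=> cf cg x; apply: (@continuous_comp _ _ _ (fun x => (f x, g x))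
  (fun p : G * G => (p.1 * p.2)%g)); last exact: mulg_continuous2.
by apply: cvg_pair; [exact: cf|exact: cg].
Qed.

Lemma conj_continuous g : continuous (conj g).
Proof.
apply: mulg_continuous; last by move=> ?; exact: cvg_cst.
by apply: mulg_continuous; [move=> ?; exact: cvg_cst|move=> ?; exact: cvg_id].
Qed.

Lemma conjr_continuous y : continuous (fun g => conj g y).
Proof.
apply: mulg_continuous; last exact: invg_continuous.
by apply: mulg_continuous; [move=> ?; exact: cvg_id|move=> ?; exact: cvg_cst].
Qed.

Let AG_chart c' : AG c' -> is_chart c'.
Proof. by have [[_ _ [+ _ _]] _ _] := G_lie; apply. Qed.

(** Multiplication is of class C^1 in charts. *)
Lemma mulg_chart_differentiable (c1 c2 c3 : chart 'rV[R]_d G) x y :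
  AG c1 -> AG c2 -> AG c3 -> dom c1 x -> dom c2 y -> dom c3 (x * y)%g ->
  differentiable (fun v : 'rV[R]_d * 'rV[R]_d =>
    coord c3 (param c1 v.1 * param c2 v.2)%g) (coord c1 x, coord c2 y).
Proof.
move=> A1 A2 A3 x1 y2 xy3.
have [_ /(_ 1%N)[_ mulC1] _] := G_lie.
have A12 : prod_atlas AG AG (prod_chart c1 c2) by exists c1, c2.
by have [+ _] := mulC1 _ _ A12 A3; apply; exists (x, y).
Qed.

Lemma param_continuous_at x : AG c -> dom c x ->
  {for coord c x, continuous (param c)}.
Proof.
move=> Ac cx; have [_ cop _ + _] := AG_chart Ac.
by rewrite continuous_open_subspace // => /(_ (coord c x)); apply; rewrite inE; exists x.
Qed.

(** Conjugation by [g] sends 1 to 1 through [g]: it is the left translation by [g],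
    read from [c] to a chart [c1] at [g], followed by the right translation by
    g^-1, read from [c1] back to [c].  Each is a partial map of the
    multiplication. *)
Lemma conj_differentiable g :
  differentiable (coord c \o conj g \o param c) (coord c 1%g).
Proof.
have [[_ _ [_ cover _]] _ _] := G_lie.
have [c1 A1 g1] := cover g; have [c2 A2 g2] := cover g^-1%g.
pose H v := coord c1 (param c1 v.1 * param c v.2)%g.
have dH : differentiable H (coord c1 g, coord c 1%g).
  by apply: mulg_chart_differentiable => //; rewrite mulg1.
pose K v := coord c (param c1 v.1 * param c2 v.2)%g.
have dK : differentiable K (coord c1 g, coord c2 g^-1%g).
  by apply: mulg_chart_differentiable => //; rewrite mulgV.
have chK c' x : AG c' -> dom c' x -> param c' (coord c' x) = x.
  by move=> /AG_chart[_ _ _ _]; apply.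
have dL : differentiable (fun v => H (coord c1 g, v)) (coord c 1%g).
  exact: differentiable_pairl dH.
have dR : differentiable (fun v => K (v, coord c2 g^-1%g)) (coord c1 g).
  exact: differentiable_pairr dK.
have LE : H (coord c1 g, coord c 1%g) = coord c1 g.
  by rewrite /H /= !chK // mulg1.
rewrite -LE in dR; apply: near_eq_differentiable (differentiable_comp dL dR).
have : \forall v \near coord c 1%g, dom c1 (g * param c v)%g.
  have pc := param_continuous_at AG_c c_1.
  have mg : {for param c (coord c 1%g), continuous (fun x => g * x)%g}.
    by apply: mulg_continuous => ?; [exact: cvg_cst|exact: cvg_id].
  have := continuous_comp pc mg; rewrite /continuous_at /= => /(_ (dom c1)); apply.
  rewrite /= chK // mulg1; apply: open_nbhs_nbhs; split => //.
  by have [] := AG_chart A1.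
apply: filterS => v cv.
by rewrite /= /K /H /= !chK.
Qed.

(* Extending the chart by 0 makes its coordinates Borel on the whole group. *)
Let coord0 (x : G) : 'rV[R]_d := if x \in dom c then coord c x else 0.


Lemma coord0_measurable i :
  measurable_fun [set: borel G] ((fun x => coord0 x 0 i) : borel G -> R).
Proof.
have [od _ cc _ _] := AG_chart AG_c.
have md : measurable (dom c : set (borel G)) by exact: sub_sigma_algebra.
rewrite (_ : (fun x => _) =
  (fun x => if x \in dom c then coord c x 0 i else 0)); last first.
  by apply/funext => x; rewrite /coord0; case: ifP; rewrite ?mxE.
apply: measurable_fun_if => //=.
- apply: (measurable_fun_bool true).
  by rewrite setTI preimage_mem_true.
- rewrite setTI preimage_mem_true; apply: within_continuous_measurable_fun => //.
  move=> x; apply: (@continuous_comp (subspace (dom c)) 'rV[R]_d R (coord c)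
    (fun v => v 0 i)); [exact: cc|exact: coord_continuous].
Qed.

(** [Ad c g v] is the limit of difference quotients of conjugation by [g] along
    steps tending to 0.  At a fixed step the quotient depends on [g] only through
    g * y * g^-1 with [y] fixed, hence continuously before the chart is applied. *)
Lemma Ad_measurable v i :
  measurable_fun [set: borel G] ((fun g => Ad c g v 0 i) : borel G -> R).
Proof.
pose t n : R := n.+1%:R^-1.
pose y n := param c (t n *: v + coord c 1%g).
pose h n (g : G) : R := (t n)^-1 * (coord0 (conj g (y n)) 0 i - coord c 1%g 0 i).
apply: (@measurable_fun_cvg _ (borel G) R setT h).
  move=> n; apply: measurable_funM => //; apply: measurable_funB => //.
  apply: (@measurableT_comp _ _ _ (borel G) (borel G) _
    (fun x => coord0 x 0 i) _ (fun g => conj g (y n))).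
    exact: coord0_measurable.
  apply: continuous_borel_measurable; exact: conjr_continuous.
move=> g _.
have dg := conj_differentiable g.
have t0 : t n @[n --> \oo] --> 0^'.
  move=> A /= fiber0.
  have : \forall n \near \oo, t n != 0 -> A (t n) by exact: cvg_harmonic fiber0.
  by apply: filterS => n; apply; rewrite /t invr_eq0 pnatr_eq0.
have c1E : param c (coord c 1%g) = 1%g.
  by have [_ _ _ _ ->] := AG_chart AG_c.
pose f := coord c \o conj g \o param c.
have fE : f (coord c 1%g) = coord c 1%g by rewrite /f /= c1E /conj mulg1 mulgV.
have fcvg : (t n)^-1 *: (f (t n *: v + coord c 1%g) - coord c 1%g) @[n --> \oo]
    --> Ad c g v.
  have <- : 'D_v f (coord c 1%g) = Ad c g v by exact: deriveE.
  rewrite -{2}fE; apply: (@cvg_comp _ _ _ t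
    (fun h => h^-1 *: (f (h *: v + coord c 1%g) - f (coord c 1%g))) _ _ _ t0).
  exact: (@diff_derivable _ _ _ f _ v dg).
have := cvg_comp _ _ fcvg (@coord_continuous R 1 d 0 i (Ad c g v)).
apply: cvg_trans; apply: near_eq_cvg.
have : \forall w \near coord c 1%g, dom c (conj g (param c w)).
  have pc := param_continuous_at AG_c c_1.
  have := @continuous_comp _ _ _ _ (conj g) _ pc (@conj_continuous g _).
  rewrite /continuous_at /= => /(_ (dom c)); apply.
  rewrite c1E /conj mulg1 mulgV; apply: open_nbhs_nbhs; split => //.
  by have [] := AG_chart AG_c.
have : (t n *: v + coord c 1%g) @[n --> \oo] --> coord c 1%g.
  rewrite -[X in _ --> X]add0r; apply: cvgD; last exact: cvg_cst.
  rewrite -[X in _ --> X](scale0r v); apply: cvgZr_tmp; exact: cvg_harmonic.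
move=> hc hd.
have : \forall n \near \oo, dom c (conj g (y n)) by exact: hc _ hd.
apply: filterS => n /= cn.
by rewrite /h /coord0 mem_set // !mxE.
Qed.

End AdjointMeasurable.

(** * Lebesgue spaces in coordinates *)

Section BorelRow.
Context {R : realType} {d : nat} {dT : measure_display} {T : measurableType dT}.

Lemma measurable_coord i :
  measurable_fun [set: borel 'rV[R]_d] ((fun v => v 0 i) : borel 'rV[R]_d -> R).
Proof.
apply: (@within_continuous_measurable_fun R 'rV[R]_d setT (fun v => v 0 i)).
  exact: openT.
by apply: continuous_subspaceT; exact: coord_continuous.
Qed.

(** An open set is the union of the balls with rational centre and radius 1/(n+1)
    that it contains, and balls for the maximum norm are boxes. *)
Lemma coord_measurableP (f : T -> 'rV[R]_d) :
  measurable_fun setT (f : T -> borel 'rV[R]_d) <-> coord_measurable f.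
Proof.
split=> [mf i|mf]; first exact: (measurableT_comp (measurable_coord i) mf).
apply: (@measurability _ _ T (borel 'rV[R]_d) setT f (@open 'rV[R]_d)) => //.
move=> _ [U oU <-]; rewrite setTI.
pose Q : set ('rV[rat]_d * nat) := [set q |
  ball (map_mx ratr q.1 : 'rV[R]_d) q.2.+1%:R^-1 `<=` U].
pose B (q : 'rV[rat]_d * nat) : set T :=
  if q \in Q then f @^-1` ball (map_mx ratr q.1 : 'rV[R]_d) q.2.+1%:R^-1 else set0.
rewrite (_ : f @^-1` U = \bigcup_q B q).
  apply: countable_bigcupT_measurable => // q; rewrite /B; case: ifP => // _.
  rewrite (_ : f @^-1` _ = \bigcap_(i in [set: 'I_d])
      [set x | `|ratr (q.1 0 i) - f x 0 i| < q.2.+1%:R^-1]).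
    apply: fin_bigcap_measurable => [|i _]; first exact: finite_finset.
    have mi : measurable_fun setT (fun x => `|ratr (q.1 0 i) - f x 0 i|).
      apply: measurableT_comp => //; apply: measurable_funB; first exact: measurable_cst.
      exact: mf.
    have := measurable_fun_ltr mi (measurable_cst (q.2.+1%:R^-1 : R)).
    move=> /(_ measurableT [set true] I); rewrite setTI.
    by rewrite (_ : _ @^-1` _ = [set x | `|ratr (q.1 0 i) - f x 0 i| < q.2.+1%:R^-1]).
  apply/seteqP; split => x /=.
    by move=> [_ h] i _ /=; have := h 0 i; rewrite mxE.
  move=> h; split; first by rewrite invr_gt0.
  by move=> j i; rewrite ord1 mxE; exact: h.
apply/seteqP; split => [x Ux|x [q _]]; last first.
  by rewrite /B; case: ifPn => // /set_mem/= + h; exact.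
have : nbhs (f x) U by apply: open_nbhs_nbhs; split.
move=> /nbhs_ballP[e /= e0 eU].
have e20 : 0 < e / 2 by rewrite divr_gt0.
have /cvgrPdist_lt/(_ _ e20)[n _ nP] := @cvg_harmonic R.
have {nP} := nP n (leqnn n); rewrite /= sub0r normrN ger0_norm // => ne.
have n0 : 0 < n.+1%:R^-1 :> R by rewrite invr_gt0.
have /choice[q qP] : forall i, exists q : rat, `|ratr q - f x 0 i| < n.+1%:R^-1.
  move=> i; have : f x 0 i < f x 0 i + n.+1%:R^-1 by rewrite ltrDl.
  move=> /rat_in_itvoo[q]; rewrite in_itv /= => /andP[q1 q2]; exists q.
  by rewrite gtr0_norm ?subr_gt0 // ltrBlDl.
exists (\row_i q i, n) => //; rewrite /B.
have -> : (\row_i q i, n) \in Q.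
  apply/mem_set => v [_ vP]; apply: eU; split => // j i.
  rewrite ord1; have := vP 0 i; rewrite !mxE /ball /= => h.
  rewrite -(subrKA (ratr (q i))) (le_lt_trans (ler_normD _ _)) //.
  have := qP i; rewrite distrC => h1.
  by rewrite (splitr e) ltrD // (lt_trans _ ne).
split => // j i; rewrite ord1 !mxE; exact: qP.
Qed.

End BorelRow.

Section Norms.
Context {R : realType} {d : nat} {X : ptopologicalType}.
Variables (mu : probability (borel X) R) (ip : 'rV[R]_d -> 'rV[R]_d -> R).
Hypothesis ip_scalar : scalar_product ip.
Implicit Types f : X -> 'rV[R]_d.

Lemma LpNorm1E f : LpNorm mu ip 1%:E f = eintegral mu (fun x : borel X => nrm ip (f x)).
Proof.
rewrite /LpNorm Lnorm1; apply: eq_integral => x _.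
by rewrite gee0_abs // lee_fin sqrtr_ge0.
Qed.

(** Taking the square first avoids the square root of a possibly infinite
    integral. *)
Lemma LpNorm2_pow f : (LpNorm mu ip 2%:E f `^ 2)%E = esqnorm mu ip (f : borel X -> _).
Proof.
rewrite /LpNorm poweR_Lnorm ?pnatr_eq0 //; apply: eq_integral => x _.
rewrite gee0_abs ?lee_fin ?sqrtr_ge0 // poweR_EFin powR_mulrn ?sqrtr_ge0 //.
by rewrite sqr_sqrtr // ip_ge0.
Qed.

Lemma LpNorm2E f : sq_integrable mu ip (f : borel X -> _) ->
  LpNorm mu ip 2%:E f = (Num.sqrt (sqnorm mu ip (f : borel X -> _)))%:E.
Proof.
move=> Lf; have := LpNorm2_pow f; rewrite (sqE ip_scalar Lf).
have : (0 <= LpNorm mu ip 2%:E f)%E by exact: Lnorm_ge0.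
case: (LpNorm mu ip 2%:E f) => [r| |] // r0.
  rewrite poweR_EFin powR_mulrn // => -[<-]; rewrite sqrtr_sqr ger0_norm //.
by rewrite poweRyr // pnatr_eq0.
Qed.

Lemma in_L2P f : in_Lp mu ip 2%:E f <-> sq_integrable mu ip (f : borel X -> _).
Proof.
split=> [[mf foo]|Lf].
  split; first exact/coord_measurableP.
  rewrite -LpNorm2_pow; have : (0 <= LpNorm mu ip 2%:E f)%E by exact: Lnorm_ge0.
  by case: (LpNorm mu ip 2%:E f) foo => [r| |] // _ _; rewrite poweR_EFin ltry.
split; first by apply/coord_measurableP; exact: Lf.1.
by rewrite LpNorm2E // ltry.
Qed.

End Norms.

(** * The theorem *)

Theorem lemma3p3 (R : realType)
    (m : nat) (X : ptopologicalType) (AX : set (chart 'rV[R]_m X))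
    (X_manifold : smooth_manifold AX) (X_compact : compact [set: X])
    (mu : probability (borel X) R)
    (F : R -> X -> X) (F_flow : C1_flow AX F) (F_mu : flow_preserves mu F)
    (d : nat) (G : groupTopologicalType) (AG : set (chart 'rV[R]_d G))
    (G_lie : lie_group AG) (G_compact : compact [set: G])
    (c : chart 'rV[R]_d G) (AG_c : AG c) (c_1 : dom c 1%g)
    (ip : 'rV[R]_d -> 'rV[R]_d -> R)
    (ip_scalar : scalar_product ip) (ip_Ad : Ad_invariant c ip)
    (phi : X -> G)
    (phi_meas : measurable_fun [set: borel X] (phi : borel X -> borel G)) :
  [/\ forall f : X -> 'rV[R]_d, in_Lp mu ip 2%:E f ->
        LpNorm mu ip 2%:E
          (fun x => ergodic_avg F c phi f N x - Pphi mu F c ip phi f x)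
          @[N --> \oo] --> 0%E,
      forall f : X -> 'rV[R]_d, in_Lp mu ip 1%:E f ->
        {ae mu, forall x, cvg (ergodic_avg F c phi f N x @[N --> \oo])} &
      forall f : X -> 'rV[R]_d, in_Lp mu ip 2%:E f ->
        {ae mu, forall x,
          ergodic_avg F c phi f N x @[N --> \oo] --> Pphi mu F c ip phi f x}].
Proof.
pose tau : borel X -> borel X := F 1.
pose A (x : borel X) := Ad c (phi x).
have mtau : measurable_fun setT tau.
  apply: continuous_borel_measurable => x.
  have [_ _ [cF _]] := F_flow.
  apply: (@continuous_comp _ _ _ (fun x => (1 : R, x)) (fun p : R * X => F p.1 p.2)).
    exact: (cvg_pair (cvg_cst (1 : R)) (@cvg_id X (nbhs x))).
  exact: cF.
have tau_mu B : measurable B -> mu (tau @^-1` B) = mu B by exact: F_mu.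
have A_linear x a u v : A x (a *: u + v) = a *: A x u + A x v by exact: linearP.
have A_isometry x u v : ip (A x u) (A x v) = ip u v by exact: ip_Ad.
have A_measurable v i : measurable_fun setT (fun x => A x v 0 i).
  exact: (measurableT_comp (Ad_measurable G_lie AG_c c_1 v i) phi_meas).
have proj f : in_Lp mu ip 2%:E f -> let p := Pphi mu F c ip phi f in
    [/\ sq_integrable mu ip (p : borel X -> _), invariant mu tau A p &
     sqnorm mu ip (fun x : borel X => mean tau A f N x - p x) @[N --> \oo] --> 0].
  move=> /(in_L2P mu ip_scalar) Lf p.
  have [h [Lh hW fh _]] :=
    mean_ergodic ip_scalar mtau tau_mu A_linear A_isometry A_measurable Lf.
  have [[/(in_L2P mu ip_scalar) Lp pW] fp] : [set h | ker_1W mu F c ip phi h /\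
      forall k, ker_1W mu F c ip phi k ->
      L2_dot mu ip (fun x => f x - h x) k = 0] p.
    rewrite /p /Pphi /orth_proj; apply: (@xgetPex _ (fun=> 0)).
    exists h; split.
      by split => //; exact/in_L2P.
    by move=> k [/(in_L2P mu ip_scalar) Lk kW]; exact: fh.
  split => //.
  apply: (mean_cvg_proj ip_scalar mtau tau_mu A_linear A_isometry A_measurable Lf Lp pW).
  by move=> k Lk kW; apply: fp; split => //; exact/in_L2P.
split=> f.
- move=> /[dup] /(in_L2P mu ip_scalar) Lf /proj[Lp pW pm].
  rewrite (_ : (fun N => _) = (fun N => (Num.sqrt (sqnorm mu ip (fun x : borel X =>
      mean tau A f N x - Pphi mu F c ip phi f x)))%:E)); last first.
    apply/funext => N; apply: (LpNorm2E ip_scalar); apply: (L2B ip_scalar) => //.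
    exact: (L2_mean ip_scalar mtau tau_mu A_linear A_isometry A_measurable).
  apply: cvg_EFin; first exact: nearW.
  rewrite -[X in _ --> X](sqrtr0 R).
  exact: (cvg_comp _ _ pm (@sqrt_continuous R 0)).
- move=> [mf foo].
  apply: (mean_pointwise_L1 ip_scalar mtau tau_mu A_linear A_isometry A_measurable).
    exact/coord_measurableP.
  by rewrite -LpNorm1E.
- move=> Lf; have [Lp pW pm] := proj f Lf.
  apply: (mean_pointwise ip_scalar mtau tau_mu A_linear A_isometry A_measurable _ Lp pW pm).
  exact/in_L2P.
Qed.
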